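(* Let $\mathcal{M}$ be the randomized algorithm DP-AGD described in the context below, run with total privacy parameters $\epsilon_{\mathsf{tot}}>0$, $\delta_{\mathsf{tot}}\in(0,1)$ and any admissible values of its other inputs. Let $\rho>0$ be the value satisfying $\epsilon_{\mathsf{tot}} = \rho + 2\sqrt{\rho\log(1/\delta_{\mathsf{tot}})}$. Then the mechanism $D\mapsto \mathcal{M}(D)$ (whose output is the returned parameter vector) satisfies $\rho$-zCDP, and it satisfies $(\epsilon_{\mathsf{tot}},\delta_{\mathsf{tot}})$-differential privacy.
   Context: Databases: $D=\{d_1,\dots,d_n\}$ is a finite multiset of records from a domain $\mathcal{D}$, with $d_i=(\vec x_i,y_i)$, $\vec x_i\in\mathbb{R}^p$, $y_i\in\mathbb{R}$. Two databases $D,D'$ are neighbors ($D\sim D'$) if one is obtained from the other by adding or removing a single record. Differential privacy: a randomized mechanism $\mathcal{M}$ is $(\epsilon,\delta)$-DP if for all $D\sim D'$ and all measurable events $S$, $\Pr[\mathcal{M}(D)\in S]\le e^{\epsilon}\Pr[\mathcal{M}(D')\in S]+\delta$. zCDP: $\mathcal{M}$ satisfies $\rho$-zCDP if for all $D\sim D'$ and all $\alpha\in(1,\infty)$, $D_\alpha(\mathcal{M}(D)\,\|\,\mathcal{M}(D'))\le \alpha\rho$, where $D_\alpha$ is the Rényi divergence of order $\alpha$ (equivalently $\mathbb{E}[e^{(\alpha-1)Z}]\le e^{(\alpha-1)\alpha\rho}$ for the privacy loss random variable $Z$). NoisyMax$(\Omega,\Delta,\epsilon)$: given a finite list of real numbers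 $\Omega=(v_0,\dots,v_{m-1})$, add to each $v_j$ an independent $\mathrm{Lap}(\Delta/\epsilon)$ random variable (Laplace with mean $0$, scale $\Delta/\epsilon$) and return the index $j$ of the largest noisy value. Problem: a loss function $\ell(\vec w;d)\ge 0$ for $\vec w\in\mathbb{R}^p$, differentiable in $\vec w$ (an optional data-independent regularizer such as $\frac\lambda2\|\vec w\|_2^2$ may be added to the objective). Clipped objective: $f_C(\vec w;D)=\sum_{i=1}^n \min(\ell(\vec w;d_i),C_{\mathsf{obj}})$. Algorithm DP-AGD. Inputs: data $D$; $\epsilon_{\mathsf{tot}},\delta_{\mathsf{tot}}$; initial budgets $\rho_{\mathsf{nmax}}>0$, $\rho_{\mathsf{ng}}>0$; rate $\gamma>0$; clipping thresholds $C_{\mathsf{obj}},C_{\mathsf{grad}}>0$; a data-independent initial point $\vec w_0$ and a finite set of step sizes $\Phi=\{\alpha_0=0,\alpha_1,\dots,\alpha_{m-1}\}$ (which may be updated between iterations as any function of previously chosen step sizes). Set $\rho$ to the solution of $\epsilon_{\mathsf{tot}}=\rho+2\sqrt{\rho\log(1/\delta_{\mathsf{tot}})}$ and $t\gets0$. While $\rho>0$: (1) compute $\vec g_t=\sum_{i=1}^n \nabla\ell(\vec w_t;d_i)/\max(1,\|\nabla\ell(\vec w_t;d_i)\|_2/C_{\mathsf{grad}})$; set $\tilde{\vec g}_t=\vec g_t+N(0,(C_{\mathsf{grad}}^2/(2\rho_{\mathsf{ng}}))I)$; $\rho\gets\rho-\rho_{\mathsf{ng}}$; $\tilde{\vec g}_t\gets\tilde{\vec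 g}_t/\|\tilde{\vec g}_t\|_2$. (2) Set $i\gets0$ and repeat while $i=0$: let $\Omega=(f_C(\vec w_t-\alpha\tilde{\vec g}_t;D))_{\alpha\in\Phi}$; $\rho\gets\rho-\rho_{\mathsf{nmax}}$; $i\gets$ NoisyMax$(-\Omega,C_{\mathsf{obj}},\sqrt{2\rho_{\mathsf{nmax}}})$. If $i>0$: if $\rho>0$ set $\vec w_{t+1}\gets\vec w_t-\alpha_i\tilde{\vec g}_t$. If $i=0$: $\rho_{\mathsf{old}}\gets\rho_{\mathsf{ng}}$, $\rho_{\mathsf{ng}}\gets(1+\gamma)\rho_{\mathsf{ng}}$, draw $\tilde{\vec g}_2=\vec g_t+N(0,(C_{\mathsf{grad}}^2/(2(\rho_{\mathsf{ng}}-\rho_{\mathsf{old}})))I)$, set $\tilde{\vec g}_t\gets(\rho_{\mathsf{old}}\tilde{\vec g}_t+(\rho_{\mathsf{ng}}-\rho_{\mathsf{old}})\tilde{\vec g}_2)/\rho_{\mathsf{ng}}$, and $\rho\gets\rho-(\rho_{\mathsf{ng}}-\rho_{\mathsf{old}})$. (3) $t\gets t+1$. Output: the most recently assigned parameter vector $\vec w$ (an iterate only ever assigned while the remaining budget $\rho$ is positive). *)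

(* Defs.v *)
From HB Require Import structures.
From mathcomp Require Import all_boot all_order all_algebra.
From mathcomp Require Import all_classical all_reals all_analysis.

Set Implicit Arguments.
Unset Strict Implicit.
Unset Printing Implicit Defensive.

Import Order.TTheory GRing.Theory Num.Theory.
Import numFieldNormedType.Exports.

Local Open Scope classical_set_scope.
Local Open Scope ring_scope.

Section privacy.
Context {R : realType}.

(** Databases are finite multisets of records, represented as sequences taken
    up to permutation.  D ~ D' iff one is obtained from the other by adding or
    removing a single record. *)
Definition neighbors {U : eqType} (D D' : seq U) : Prop :=
  (exists r, perm_eq D' (r :: D)) \/ (exists r, perm_eq D (r :: D')).

Definition is_density d (T : measurableType d) (Pm Q : set T -> \bar R)
    (f : T -> R) : Prop :=
  [/\ measurable_fun [set: T] f, (forall x, 0 <= f x) &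
      forall A, measurable A -> Pm A = (\int[Q]_(x in A) (f x)%:E)%E].

(** Renyi divergence of order [a] (a > 1):
      D_a(Pm || Q) = 1/(a-1) * ln (\int (dPm/dQ)^a dQ)   if Pm << Q and the
    integral is finite, and +oo otherwise.  (The integral does not depend on
    the version of the density; the infimum of the empty set is +oo.) *)
Definition renyi_div d (T : measurableType d) (a : R) (Pm Q : set T -> \bar R)
  : \bar R :=
  ereal_inf [set ((a - 1)^-1 * ln v)%:E | v in
    [set v : R | exists f, is_density Pm Q f /\
                 (\int[Q]_x ((f x) `^ a)%:E)%E = v%:E]].

Definition out_law d (Omega : measurableType d) d' (O : measurableType d')
    (P : probability Omega R) {U : Type} (M : U -> Omega -> O) (D : U)
  : set O -> \bar R := pushforward P (M D).

Definition zCDP d (Omega : measurableType d) d' (O : measurableType d')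
    (P : probability Omega R) {U : eqType} (M : seq U -> Omega -> O) (rho : R)
  : Prop :=
  forall D D', neighbors D D' ->
  forall a : R, 1 < a ->
    (renyi_div a (out_law P M D) (out_law P M D') <= (a * rho)%:E)%E.

Definition DP d (Omega : measurableType d) d' (O : measurableType d')
    (P : probability Omega R) {U : eqType} (M : seq U -> Omega -> O)
    (eps delta : R) : Prop :=
  forall D D', neighbors D D' ->
  forall S : set O, measurable S ->
    (P (M D @^-1` S) <= (expR eps)%:E * P (M D' @^-1` S) + delta%:E)%E.

Definition laplace_prob (b : R) : set R -> \bar R :=
  fun A => (\int[lebesgue_measure]_(x in A)
              ((2 * b)^-1 * expR (- `|x| / b))%:E)%E.

Definition mutually_independent d (Omega : measurableType d)
    (P : probability Omega R) {I : eqType} (X : I -> Omega -> R) : Prop :=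
  forall s : seq I, uniq s ->
  forall B : I -> set R, (forall i, measurable (B i)) ->
    P (\big[setI/setT]_(i <- s) (X i @^-1` B i)) =
    (\prod_(i <- s) P (X i @^-1` B i))%E.

End privacy.

Section dpagd.
Context {R : realType} {p : nat}.
Local Notation vec := 'rV[R]_p.
Local Notation record := (vec * R)%type.

Definition norm2 (v : vec) : R := Num.sqrt (\sum_(j < p) v 0 j ^+ 2).

Definition grad (f : vec -> R) (w : vec) : vec :=
  \row_(j < p) 'D_(delta_mx 0 j) f w.

Definition f_clip (loss : vec -> record -> R) (C_obj : R) (w : vec)
    (D : seq record) : R :=
  \sum_(r <- D) Num.min (loss w r) C_obj.

Definition clipped_grad_sum (loss : vec -> record -> R) (C_grad : R) (w : vec)
    (D : seq record) : vec :=
  \sum_(r <- D)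
    (Num.max 1 (norm2 (grad (loss^~ r) w) / C_grad))^-1 *: grad (loss^~ r) w.

Definition argmax_first (s : seq R) : nat :=
  foldl (fun best j => if nth 0 s best < nth 0 s j then j else best)
        0%N (iota 0 (size s)).

(** NoisyMax(vals, Delta, eps): adds Lap(Delta/eps) noise to each value
    (realized as (Delta/eps) * lap j with lap j a standard Laplace variable)
    and returns the index of the largest noisy value. *)
Definition noisy_max (vals : seq R) (Delta eps : R) (lap : nat -> R) : nat :=
  argmax_first [seq nth 0 vals j + (Delta / eps) * lap j
               | j <- iota 0 (size vals)].

(** Internal state of the algorithm:
    current iterate, remaining budget rho, current rho_ng, current (noisy)
    direction, history of chosen step sizes, counters of Gaussian draws and of
    NoisyMax calls, and whether a fresh noisy gradient must be drawn (step 1)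
    or we are in the NoisyMax loop (step 2). *)
Record state := St {
  st_w : vec; st_rho : R; st_rng : R; st_g : vec; st_hist : seq R;
  st_kG : nat; st_kL : nat; st_needgrad : bool }.

Section run.
Variables (loss : vec -> record -> R) (reg : vec -> R)
          (rho_nmax gamma C_obj C_grad : R) (steps : seq R -> seq R)
          (D : seq record)
          (gauss : nat -> 'I_p -> R) (lap : nat -> nat -> R).

(** k-th noisy gradient at w with noise N(0, sigma^2 I) realized as
    sigma * (gauss k), gauss k a vector of standard normals.  The gradient of
    the data-independent regularizer is added (it is 0 when reg = 0). *)
Definition noisy_grad (w : vec) (sigma : R) (k : nat) : vec :=
  clipped_grad_sum loss C_grad w D + grad reg w + sigma *: \row_j gauss k j.

Fixpoint run (fuel : nat) (s : state) : vec :=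
  let: St w rho rng g hist kG kL needgrad := s in
  match fuel with
  | 0%N => w
  | n.+1 =>
    if rho <= 0 then w else
    if needgrad then
      let gt := noisy_grad w (C_grad / Num.sqrt (2 * rng)) kG in
      run n (St w (rho - rng) rng ((norm2 gt)^-1 *: gt) hist kG.+1 kL false)
    else
      let Phi := 0 :: steps hist in
      let vals := [seq - (f_clip loss C_obj (w - a *: g) D + reg (w - a *: g))
                  | a <- Phi] in
      let rho1 := rho - rho_nmax in
      let i := noisy_max vals C_obj (Num.sqrt (2 * rho_nmax)) (lap kL) in
      let a := nth 0 Phi i in
      let hist' := rcons hist a in
      if (0 < i)%N then
        run n (St (if 0 < rho1 then w - a *: g else w) rho1 rng g hist'
                  kG kL.+1 true)
      else
        let rng' := (1 + gamma) * rng in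
        let g2 := noisy_grad w (C_grad / Num.sqrt (2 * (rng' - rng))) kG in
        run n (St w (rho1 - (rng' - rng)) rng'
                  (rng'^-1 *: (rng *: g + (rng' - rng) *: g2)) hist'
                  kG.+1 kL.+1 false)
  end.

End run.

Definition out_space := g_sigma_algebraType (@open vec).

(** The mechanism DP-AGD: database |-> returned parameter vector, as a
    function of the randomness omega.  The fuel is large enough for the run to
    reach budget exhaustion (every NoisyMax call spends rho_nmax > 0). *)
Definition dpagd d (Omega : measurableType d)
    (gauss : nat -> 'I_p -> Omega -> R) (lap : nat -> nat -> Omega -> R)
    (loss : vec -> record -> R) (reg : vec -> R)
    (rho rho_nmax rho_ng gamma C_obj C_grad : R) (w0 : vec)
    (steps : seq R -> seq R) (D : seq record) (omega : Omega) : out_space :=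
  run loss reg rho_nmax gamma C_obj C_grad steps D
      (fun k j => gauss k j omega) (fun k j => lap k j omega)
      ((Num.truncn (rho / rho_nmax)).+2).*2
      (St w0 rho rho_ng 0 [::] 0 0 true).

Definition noise_family d (Omega : measurableType d)
    (gauss : nat -> 'I_p -> Omega -> R) (lap : nat -> nat -> Omega -> R)
  : ((nat * 'I_p) + (nat * nat))%type -> Omega -> R :=
  fun i => match i with
           | inl (k, j) => gauss k j
           | inr (k, j) => lap k j
           end.

End dpagd.

(* Main.v *)
(** Fix [a > 1] and put [theta = (a - 1) / a].  By Hoelder duality, a bound
    [D_a(X || Y) <= a * r] is equivalent to
    [E u(X)^theta <= e^((a - 1) * r) * (E u(Y))^theta] for all measurable [u >= 0].
    In this dual form post-processing is immediate and adaptive composition is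
    Fubini's theorem, so one never has to handle densities along a run.
    A Gaussian step costs the squared shift (clipping bounds it), by completing the
    square; a NoisyMax step is [eps]-DP, since the clipped objectives of neighbouring
    databases all move in the same direction by at most [C_obj] and the Laplace noise
    of the winning index absorbs this, and [eps]-DP costs [eps^2 / 2] by a convexity
    argument that reduces to the decay of [cosh t * e^(-t^2 / 2)].
    An iterate is assigned only while the remaining budget is positive, so a step
    that would exhaust the budget has no influence on the output; induction on the
    fuel therefore charges at most the initial budget.  Finally the Radon-Nikodym
    theorem turns the dual bound at the laws of the outputs back into a density, and
    Markov's inequality at the optimal order gives (eps, delta)-DP. *)

Require Import Defs.
From HB Require Import structures.
From mathcomp Require Import all_boot all_order all_algebra.
From mathcomp Require Import all_classical all_reals all_analysis.
From mathcomp Require Import measurable_realfun ring lra.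
Import Order.TTheory GRing.Theory Num.Theory.
Import numFieldNormedType.Exports.
Import HBNNSimple.
Local Open Scope classical_set_scope.
Local Open Scope ring_scope.

Set Implicit Arguments.
Unset Strict Implicit.
Unset Printing Implicit Defensive.

(** * Integration *)

Lemma measurable_poweR (R : realType) (r : R) :
  measurable_fun [set: \bar R] (fun x : \bar R => (x `^ r)%E).
Proof.
have -> : (fun x : \bar R => (x `^ r)%E) =
    (fun x => if x \is a fin_num then (fine x `^ r)%:E
              else if x == +oo%E then (+oo `^ r)%E else (-oo `^ r)%E).
  by apply/funext => -[].
apply: measurable_fun_ifT => //=.
- apply: (@measurable_fun_bool _ _ setT (fun x : \bar R => x \is a fin_num) true).
  exact: emeasurable_fin_num.
- by apply/measurable_EFinP; exact: (@measurableT_comp _ _ _ _ _ _ (@powR R ^~ r) _ fine).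
- apply: measurable_fun_ifT => //=.
  apply: (@measurable_fun_bool _ _ setT (fun x : \bar R => x == +oo%E) true); rewrite setTI.
  rewrite (_ : _ @^-1` _ = [set +oo%E]); first exact: emeasurable_set1.
  by apply/seteqP; split => x /= => [/eqP|->].
Qed.

(** Both sides are monotone limits along simple functions approximating [g], and for the indicator
    of a measurable set the identity is the hypothesis on [mu]. *)
Lemma integral_density d (T : measurableType d) (R : realType)
    (mu nu : {measure set T -> \bar R}) (f : T -> R) :
  measurable_fun [set: T] f -> (forall x, 0 <= f x) ->
  (forall A, measurable A -> mu A = \int[nu]_(x in A) (f x)%:E)%E ->
  forall g : T -> \bar R, measurable_fun [set: T] g -> (forall x, 0 <= g x)%E ->
  (\int[mu]_x g x = \int[nu]_x (g x * (f x)%:E))%E.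
Proof.
move=> mf f0 muf g mg g0; pose h := nnsfun_approx measurableT mg.
have hE x : (EFin \o h n) x @[n --> \oo] --> g x by exact: cvg_nnsfun_approx.
have -> : (\int[mu]_x g x = lim (\int[mu]_x (EFin \o h n) x @[n --> \oo]))%E.
  rewrite -monotone_convergence//.
  - by apply: eq_integral => x _; apply/esym/cvg_lim.
  - by move=> n; exact/measurable_EFinP/measurable_funP.
  - by move=> n x _; rewrite lee_fin.
  - by move=> x _ a b ab; rewrite lee_fin; exact/lefP/nd_nnsfun_approx.
have -> : (\int[nu]_x (g x * (f x)%:E) =
    lim (\int[nu]_x ((EFin \o h n) x * (f x)%:E) @[n --> \oo]))%E.
  rewrite -monotone_convergence//.
  - by apply: eq_integral => x _; apply/esym/cvg_lim => //; apply: cvgeZr.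
  - move=> n; apply: emeasurable_funM; apply/measurable_EFinP => //.
  - by move=> n x _; rewrite mule_ge0 ?lee_fin.
  - by move=> x _ a b ab; rewrite lee_wpmul2r ?lee_fin//; exact/lefP/nd_nnsfun_approx.
congr (lim (_ @ \oo)); apply/funext => n.
transitivity (\int[mu]_x (\sum_(y \in range (h n))
    (y * \1_(h n @^-1` [set y]) x)%:E))%E.
  by apply: eq_integral => t _; rewrite /= fimfunE -fsumEFin.
rewrite ge0_integral_fsum//; last 2 first.
- by move=> r; exact/measurable_EFinP/measurable_funM.
- by move=> y x _; exact: nnfun_muleindic_ge0.
transitivity (\int[nu]_x (\sum_(y \in range (h n))
    (y * \1_(h n @^-1` [set y]) x)%:E * (f x)%:E))%E; last first.
  apply: eq_integral => x _ /=.
  rewrite -ge0_mule_fsuml => [|y]; last exact: nnfun_muleindic_ge0.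
  by rewrite fsumEFin // -(fimfunE _ x).
rewrite ge0_integral_fsum//; last 2 first.
- move=> y; apply: emeasurable_funM; last exact/measurable_EFinP.
  exact/measurable_EFinP/measurable_funM.
- by move=> y x _; rewrite mule_ge0 ?lee_fin// -lee_fin nnfun_muleindic_ge0.
apply: eq_fsbigr => r; rewrite inE => -[t _ rE].
have r0 : 0 <= r by rewrite -rE.
have mr : measurable (h n @^-1` [set r]) by [].
under eq_integral do rewrite EFinM.
rewrite ge0_integralZl//; last exact/measurable_EFinP.
rewrite integral_indic// setIT.
under [RHS]eq_integral do rewrite EFinM -muleA.
rewrite ge0_integralZl//; last 2 first.
- by apply: emeasurable_funM; exact/measurable_EFinP.
- by move=> x _; rewrite mule_ge0 ?lee_fin.
congr (_ * _)%E; rewrite muf// integral_mkcond; apply: eq_integral => x _.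
by rewrite epatch_indic muleC.
Qed.

Lemma lebesgue_measureD (R : realType) (m : R) (A : set R) : measurable A ->
  pushforward lebesgue_measure ((fun t => t + m) : _ -> measurableTypeR R) A =
  lebesgue_measure A.
Proof.
move=> mA.
have mshift : measurable_fun setT ((fun t => t + m) : measurableTypeR R -> measurableTypeR R).
  exact: measurable_funD.
apply/esym; apply: (@lebesgue_measure_unique R (pushforward lebesgue_measure ((fun t => t + m) : measurableTypeR R -> measurableTypeR R))) => //= _ [[a b]] _ <-.
rewrite /pushforward [X in _ = lebesgue_measure X](_ : _ = `]a - m, b - m]%classic).
  rewrite !lebesgue_measure_itv/= !lte_fin ltrD2r.
  by case: ifP => // _; rewrite -?EFinN -?EFinD; congr EFin; ring.
apply/seteqP; split=> x; rewrite /= !in_itv/= ltrBlDr lerBrDr//.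
Qed.

Lemma ge0_integral_shift (R : realType) (m : R) (g : R -> \bar R) :
  measurable_fun [set: R] g -> (forall x, 0 <= g x)%E ->
  (\int[lebesgue_measure]_x g (x + m)%R = \int[lebesgue_measure]_x g x)%E.
Proof.
move=> mg g0.
have mshift : measurable_fun setT ((fun t => t + m) : measurableTypeR R -> measurableTypeR R).
  exact: measurable_funD.
transitivity (\int[pushforward lebesgue_measure ((fun t => t + m)%R : measurableTypeR R -> measurableTypeR R)]_x g x)%E.
  by rewrite ge0_integral_pushforward.
by apply: eq_measure_integral => //= A mA _; exact: lebesgue_measureD.
Qed.

(** Hoelder's inequality with the conjugate exponents [a / (a - 1)] and [a]. With [f] a likelihood
    ratio and [K] a bound on its moment of order [a], this is the passage to the dual form; the
    Gaussian and the pure DP bound both end here. *)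
Lemma integral_poweR_density d (T : measurableType d) (R : realType)
    (mu : {measure set T -> \bar R}) (f : T -> R) (u : T -> \bar R) (a K : R) :
  1 < a -> 0 < K ->
  measurable_fun [set: T] f -> (forall x, 0 <= f x) ->
  measurable_fun [set: T] u -> (forall x, 0 <= u x)%E ->
  (\int[mu]_x (f x `^ a)%:E <= K%:E)%E ->
  (\int[mu]_x (u x `^ ((a - 1) / a) * (f x)%:E) <=
   (K `^ a^-1)%:E * (\int[mu]_x u x) `^ ((a - 1) / a))%E.
Proof.
move=> a1 K0 mf f0 mu_ u0 fK; set th := (a - 1) / a.
have a0 : 0 < a by rewrite (lt_trans ltr01).
have th0 : 0 < th by rewrite divr_gt0 ?subr_gt0.
have iu0 : (0 <= \int[mu]_x u x)%E by exact: integral_ge0.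
(* An infinite integral makes the right-hand side [+oo]; otherwise [u] is finite almost everywhere
   and may be replaced by the real function [v]. *)
have [iuoo|] := eqVneq (\int[mu]_x u x)%E +oo%E.
  by rewrite iuoo poweRyr ?gt_eqF// gt0_muley ?leey// lte_fin powR_gt0.
rewrite -ltey => iuoo.
have iu : mu.-integrable [set: T] u.
  apply/integrableP; split => //.
  by under eq_integral do rewrite gee0_abs//.
have ufin : {ae mu, forall x, [set: T] x -> u x \is a fin_num}.
  exact: integrable_ae.
pose v x := fine (u x).
have v0 x : 0 <= v x by exact: fine_ge0.
have mv : measurable_fun setT v by exact: measurableT_comp.
have mvth : measurable_fun setT (fun x => v x `^ th).
  exact: (@measurableT_comp _ _ _ _ _ _ (@powR R ^~ th)).
have muth : measurable_fun setT (fun x => u x `^ th)%E.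
  by apply: (@measurableT_comp _ _ _ _ _ _ (fun x : \bar R => x `^ th)%E) => //; exact: measurable_poweR.
have -> : (\int[mu]_x u x = \int[mu]_x (v x)%:E)%E.
  apply: ae_eq_integral => //; first exact/measurable_EFinP.
  by apply: filterS ufin => x /[apply] ux; rewrite fineK.
have -> : (\int[mu]_x (u x `^ th * (f x)%:E) = \int[mu]_x (v x `^ th * f x)%:E)%E.
  apply: ae_eq_integral => //.
  - by apply: emeasurable_funM => //; exact/measurable_EFinP.
  - by apply/measurable_EFinP; exact: measurable_funM.
  - by apply: filterS ufin => x /[apply] ux; rewrite EFinM -poweR_EFin fineK.
have pq : (th^-1)^-1 + a^-1 = 1 by rewrite invrK /th; field; rewrite gt_eqF.
have := @hoelder _ _ _ mu (fun x => v x `^ th) f th^-1 a mvth mf _ a0 pq.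
rewrite invr_gt0 => /(_ th0).
rewrite Lnorm1 [X in (X <= _)%E -> _](_ : _ = \int[mu]_x (v x `^ th * f x)%:E)%E; last first.
  by apply: eq_integral => x _ /=; rewrite ger0_norm// mulr_ge0// powR_ge0.
move=> /le_trans; apply; rewrite unlock invrK.
have -> : (\int[mu]_x (`|(v x `^ th)%:E| `^ th^-1) =
    \int[mu]_x (v x)%:E)%E.
  apply: eq_integral => x _ /=.
  by rewrite ger0_norm ?powR_ge0// -powRrM divff ?gt_eqF// powRr1.
rewrite [leRHS]muleC; apply: lee_wpmul2l; first exact: poweR_ge0.
rewrite -poweR_EFin.
have -> : (\int[mu]_x (`|(f x)%:E| `^ a) = \int[mu]_x (f x `^ a)%:E)%E.
  by apply: eq_integral => x _ /=; rewrite ger0_norm.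
apply: gt0_ler_poweR => //; first by rewrite invr_ge0 ltW.
- by rewrite in_itv /= leey andbT integral_ge0// => x _; rewrite lee_fin powR_ge0.
- by rewrite in_itv /= leey andbT lee_fin ltW.
Qed.

(** * Numerical inequalities behind the cost of pure DP *)

(** The difference of the two sides vanishes at 0 and has derivative [t * (expR t - expR (- t))],
    nonnegative for [t >= 0]. *)
Lemma sinh_le_mul_cosh (R : realType) (t : R) : 0 <= t ->
  expR t - expR (- t) <= t * (expR t + expR (- t)).
Proof.
move=> t0.
pose h (t : R) : R := t * (expR t + expR (- t)) - (expR t - expR (- t)).
have dh (x : R) : is_derive (x : R) (1 : R) h (x * (expR x - expR (- x))).
  rewrite /h; apply: is_derive_eq; rewrite /GRing.scale/=; ring.
rewrite -subr_ge0 -/(h t).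
have <- : h 0 = 0 by rewrite /h oppr0; ring.
apply: (@ger0_derive1_ndecr _ h 0 t) => //.
- move=> x /[!in_itv]/= /andP[x0 _]; rewrite derive1E; have [_ ->] := dh x.
  by apply: mulr_ge0; [exact: ltW|rewrite subr_ge0 ler_expR; lra].
- apply: continuous_subspaceT => x; apply: differentiable_continuous.
  by apply/derivable1_diffP; have [] := dh x.
Qed.

(** By the previous inequality the derivative of [2 * cosh t * exp (- t^2 / 2)] is nonpositive for
    [t >= 0]. *)
Lemma cosh_gauss_decr (R : realType) (x y : R) : 0 <= x -> x <= y ->
  expR (- (y ^+ 2 / 2)) * (expR y + expR (- y)) <=
  expR (- (x ^+ 2 / 2)) * (expR x + expR (- x)).
Proof.
move=> x0 xy.
pose h (t : R) : R := expR (- (t ^+ 2 / 2)) * (expR t + expR (- t)).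
have dh (t : R) : is_derive (t : R) (1 : R) h
    (expR (- (t ^+ 2 / 2)) * (expR t - expR (- t) - t * (expR t + expR (- t)))).
  by rewrite /h; apply: is_derive_eq; rewrite /GRing.scale/=; field.
change (h y <= h x).
apply: (@ler0_derive1_nincr _ h x y) => //.
- move=> z /[!in_itv]/= /andP[xz _]; rewrite derive1E; have [_ ->] := dh z.
  rewrite pmulr_rle0 ?expR_gt0// subr_le0 sinh_le_mul_cosh//.
  by rewrite (le_trans x0)// ltW.
- apply: continuous_subspaceT => z; apply: differentiable_continuous.
  by apply/derivable1_diffP; have [] := dh z.
Qed.

(** Convexity of [t^a]: the right-hand side is the chord over the interval from [expR (- eps)] to
    [expR eps], written so that it is visibly affine in [t]. *)
Lemma powR_le_chord (R : realType) (a eps t : R) : 1 <= a -> 0 < eps ->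
  expR (- eps) <= t <= expR eps ->
  t `^ a <= ((expR eps - t) * expR (- (a * eps)) + (t - expR (- eps)) * expR (a * eps))
            / (expR eps - expR (- eps)).
Proof.
move=> a1 e0 /andP[t1 t2].
have D0 : 0 < expR eps - expR (- eps) by rewrite subr_gt0 ltr_expR; lra.
pose l := (expR eps - t) / (expR eps - expR (- eps)).
have l01 : 0 <= l <= 1.
  apply/andP; split; first by apply: divr_ge0; [rewrite subr_ge0|exact: ltW].
  by rewrite ler_pdivrMr// mul1r lerD2l lerN2.
have := @convex_powR R a a1.
move=> /(_ (@Itv01 R l (proj1 (andP l01)) (proj2 (andP l01))) (expR (-eps)) (expR eps)).
rewrite !inE /= !in_itv/= !expR_ge0 => /(_ isT isT).
rewrite !convRE /= /unstable.onem => h.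
have {}h : (l * expR (- eps) + (1 - l) * expR eps) `^ a <=
    l * expR (- eps) `^ a + (1 - l) * expR eps `^ a by exact: h.
have tE : t = l * expR (- eps) + (1 - l) * expR eps.
  by rewrite /l; field; rewrite gt_eqF.
rewrite {1}tE (le_trans h)// -!expRM le_eqVlt; apply/orP; left; apply/eqP.
rewrite mulNr ![_ * a]mulrC /l.
by field; rewrite gt_eqF.
Qed.

(** With [x = eps / 2] and [y = (2 * a - 1) * eps / 2] the chord takes at 1 the value
    [cosh y / cosh x]. As [x <= y], this is at most [exp ((y^2 - x^2) / 2)], and
    [y^2 - x^2 = a * (a - 1) * eps^2]. *)
Lemma chord_at_1_le (R : realType) (a eps : R) : 1 <= a -> 0 < eps ->
  ((expR eps - 1) * expR (- (a * eps)) + (1 - expR (- eps)) * expR (a * eps))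
     / (expR eps - expR (- eps)) <= expR (a * (a - 1) * (eps ^+ 2 / 2)).
Proof.
move=> a1 e0.
have D0 : 0 < expR eps - expR (- eps) by rewrite subr_gt0 ltr_expR; lra.
have := @cosh_gauss_decr R (eps / 2) ((2 * a - 1) * eps / 2).
move=> /(_ ltac:(lra) ltac:(nra)).
set x := eps / 2; set y := (_ * eps / 2) => h.
have eE : eps = x + x by rewrite /x; lra.
have aE : a * eps = y + x by rewrite /x /y; lra.
have E : expR (a * (a - 1) * (eps ^+ 2 / 2)) = expR (y ^+ 2 / 2) * expR (- (x ^+ 2 / 2)).
  by rewrite -expRD; congr expR; rewrite /x /y; field.
rewrite ler_pdivrMr// E aE eE !opprD !expRD.
move: h; set u := expR x; set v := expR y; set w := expR (y ^+ 2 / 2); set z := expR (- (x^+2/2)).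
have u0 : 0 < u by exact: expR_gt0.
have v0 : 0 < v by exact: expR_gt0.
have w0 : 0 < w by exact: expR_gt0.
have z0 : 0 < z by exact: expR_gt0.
rewrite !expRN -/u -/v -/w => h.
have h2 : v + v^-1 <= w * z * (u + u^-1).
  by move: h; rewrite ler_pdivrMl// mulrA.
have uu : 0 <= u - u^-1.
  by rewrite /u -expRN subr_ge0 ler_expR /x; lra.
have -> : (u * u - 1) * (v^-1 * u^-1) + (1 - u^-1 * u^-1) * (v * u) = (v + v^-1) * (u - u^-1).
  by field; rewrite !gt_eqF.
have -> : w * z * (u * u - u^-1 * u^-1) = w * z * (u + u^-1) * (u - u^-1).
  by field; rewrite !gt_eqF.
exact: ler_wpM2r.
Qed.

(** * From the dual bound to densities, Renyi divergence and (eps, delta)-DP *)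

(** Indicators as test functions give absolute continuity, hence a Radon-Nikodym density [F].
    Testing with the [a]-th power of [F] truncated at [n] bounds the truncated moment by a multiple
    of its own power [(a - 1) / a]; one cancels that power and lets [n] grow. *)
Lemma density_of_dual d (T : measurableType d) (R : realType)
    (mu nu : probability T R) (a r : R) : 1 < a ->
  (forall u : T -> \bar R, measurable_fun [set: T] u -> (forall x, 0 <= u x)%E ->
    (\int[mu]_x (u x `^ ((a - 1) / a)) <=
     (expR ((a - 1) * r))%:E * (\int[nu]_x u x) `^ ((a - 1) / a))%E) ->
  exists f : T -> R, is_density mu nu f /\
    (\int[nu]_x (f x `^ a)%:E <= (expR (a * (a - 1) * r))%:E)%E.
Proof.
move=> a1 dual; set th := (a - 1) / a in dual.
have a0 : 0 < a by rewrite (lt_trans ltr01).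
have th0 : 0 < th by rewrite divr_gt0 ?subr_gt0.
have dom : mu `<< nu.
  apply/null_content_dominatesP => A mA nuA0.
  have := dual (fun x => (\1_A x)%:E).
  have mI : measurable_fun setT (fun x => (\1_A x : R)%:E).
    by apply/measurable_EFinP; exact: measurable_indic.
  move=> /(_ mI (fun x => _)); rewrite integral_indic// setIT nuA0.
  rewrite poweR0r ?gt_eqF// mule0.
  have -> : (\int[mu]_x ((\1_A x)%:E `^ th) = mu A)%E.
    rewrite -[in RHS](setIT A) -integral_indic//; apply: eq_integral => x _.
    rewrite poweR_EFin indicE; case: (_ \in _); first by rewrite powR1.
    by rewrite powR0 ?gt_eqF.
  by move=> H; apply/eqP; rewrite eq_le measure_ge0 andbT H// => x; rewrite lee_fin.
pose g := Radon_Nikodym_SigmaFinite.f mu nu.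
pose F x := fine (g x).
have gF x : g x = (F x)%:E by rewrite fineK// Radon_Nikodym_SigmaFinite.f_fin_num.
have F0 x : 0 <= F x by rewrite -lee_fin -gF Radon_Nikodym_SigmaFinite.f_ge0.
have mF : measurable_fun setT F.
  apply/measurable_EFinP; rewrite (_ : EFin \o F = g); last by apply/funext => x; rewrite gF.
  exact: measurable_int (Radon_Nikodym_SigmaFinite.f_integrable dom).
have dF A : measurable A -> (mu A = \int[nu]_(x in A) (F x)%:E)%E.
  move=> mA; rewrite (Radon_Nikodym_SigmaFinite.f_integral dom)//.
  by apply: eq_integral => x _; rewrite -/g gF.
exists F; split => //.
(* The truncation makes the moment finite, which the cancellation below requires. *)
pose h n x := Num.min (F x) n%:R.
have h0 n x : 0 <= h n x by rewrite le_min F0/=.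
have mh n : measurable_fun setT (h n) by exact: measurable_minr.
have mhp n (q : R) : measurable_fun setT (fun x => h n x `^ q).
  exact: (@measurableT_comp _ _ _ _ _ _ (@powR R ^~ q)).
pose u n x := (h n x `^ a)%:E.
have u0 n x : (0 <= u n x)%E by rewrite lee_fin powR_ge0.
have mu' n : measurable_fun setT (u n) by exact/measurable_EFinP.
have Ifin n : (\int[nu]_x u n x < +oo)%E.
  apply: (@le_lt_trans _ _ (\int[nu]_x (cst (n%:R `^ a)%:E x))%E).
    apply: ge0_le_integral => //.
    move=> x _; rewrite lee_fin ge0_ler_powR ?nnegrE//; first exact: ltW.
    by rewrite ge_min lexx orbT.
  by rewrite integral_cst// [X in (_ * X)%E](@probability_setT _ _ _ nu) mule1 ltry.
(* The power [th] of [u n] is the power [a - 1] of [h n]; passing from [mu] to [nu] multiplies by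
   the density [F], which dominates the missing factor [h n]. *)
have key n : (\int[nu]_x u n x <= (expR ((a - 1) * r))%:E * (\int[nu]_x u n x) `^ th)%E.
  apply: le_trans (dual _ (mu' n) (u0 n)).
  have -> : (\int[mu]_x (u n x `^ th) = \int[nu]_x ((h n x `^ (a - 1))%:E * (F x)%:E))%E.
    rewrite -(integral_density mF F0 dF); last 2 first.
    - exact/measurable_EFinP.
    - by move=> x; rewrite lee_fin powR_ge0.
    apply: eq_integral => x _; rewrite /u poweR_EFin -powRrM /th.
    by rewrite mulrCA divff ?gt_eqF// mulr1.
  apply: ge0_le_integral => //.
  - by apply: emeasurable_funM; exact/measurable_EFinP.
  - move=> x _; rewrite -EFinM lee_fin.
    have -> : h n x `^ a = h n x `^ (a - 1) * h n x.
      rewrite -[X in _ * X]powRr1// -powRD ?subrK// gt_eqF//.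
    by rewrite ler_wpM2l ?powR_ge0// ge_min lexx.
have bound n : (\int[nu]_x u n x <= (expR (a * (a - 1) * r))%:E)%E.
  have := key n.
  have I0 : (0 <= \int[nu]_x u n x)%E by exact: integral_ge0.
  have := Ifin n; move: I0; case: (\int[nu]_x u n x)%E => // v.
  rewrite poweR_EFin -EFinM !lee_fin => v0 _ vle.
  have [->|vn0] := eqVneq v 0; first exact: expR_ge0.
  have vp : 0 < v by rewrite lt_neqAle eq_sym vn0.
  (* The exponents [th] and [a^-1] sum to 1, so dividing by the power [th] of [v] leaves a bound on
     its [a]-th root. *)
  have vE : v = v `^ th * v `^ a^-1.
    rewrite -powRD; last by rewrite vn0 implybT.
    have -> : th + a^-1 = 1 by rewrite /th; field; rewrite gt_eqF.
    by rewrite powRr1.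
  have : v `^ a^-1 <= expR ((a - 1) * r).
    by move: vle; rewrite {1}vE [leRHS]mulrC ler_pM2l// powR_gt0.
  move=> /(@ge0_ler_powR _ a); rewrite !nnegrE powR_ge0 expR_ge0 => /(_ (ltW a0) isT isT).
  rewrite -powRrM mulVf ?gt_eqF// powRr1// -expRM.
  by rewrite mulrC mulrA.
have -> : (\int[nu]_x (F x `^ a)%:E = \int[nu]_x (limn (u ^~ x)))%E.
  apply: eq_integral => x _; apply/esym/cvg_lim => //.
  apply: cvg_near_cst; near=> n.
  rewrite /u /h min_l//.
  by near: n; exact: nbhs_infty_ger.
have nd x : nondecreasing_seq (u ^~ x).
  move=> m n mn; rewrite lee_fin ge0_ler_powR ?nnegrE//; first exact: ltW.
  by rewrite /h le_min !ge_min lexx/= ler_nat mn orbT.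
rewrite monotone_convergence//.
apply: lime_le; last by apply: nearW.
apply: ereal_nondecreasing_is_cvgn => m n mn.
by apply: ge0_le_integral => // x _; exact: nd.
Unshelve. all: by end_near. Qed.

Lemma renyi_div_le d (T : measurableType d) (R : realType)
    (mu : set T -> \bar R) (nu : {measure set T -> \bar R}) (f : T -> R) (a r : R) :
  1 < a -> 0 <= r -> is_density mu nu f ->
  (\int[nu]_x (f x `^ a)%:E <= (expR (a * (a - 1) * r))%:E)%E ->
  (renyi_div a mu nu <= (a * r)%:E)%E.
Proof.
move=> a1 r0 df; have I0 : (0 <= \int[nu]_x (f x `^ a)%:E)%E.
  by apply: integral_ge0 => x _; rewrite lee_fin powR_ge0.
case IE : (\int[nu]_x (f x `^ a)%:E)%E I0 => [v| |]; rewrite ?leNye// lee_fin => v0.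
rewrite lee_fin => vle; apply: (@le_trans _ _ ((a - 1)^-1 * ln v)%:E).
  by apply: ereal_inf_lbound; exists v => //; exists f.
have am1 : 0 < a - 1 by rewrite subr_gt0.
rewrite lee_fin ler_pdivrMl// mulrA [(a - 1) * a]mulrC.
have [vp|vn] := ltP 0 v.
  by rewrite -[leRHS]expRK ler_ln// posrE expR_gt0.
(* [mu] is an arbitrary set function here, so [v] may vanish; with the convention [ln 0 = 0] the
   bound to prove is then the nonnegativity of its right-hand side. *)
have -> : v = 0 by apply/eqP; rewrite eq_le vn v0.
rewrite ln0//; apply: mulr_ge0 => //; apply: mulr_ge0; lra.
Qed.

(** Markov's inequality in pointwise form: either [f <= expR eps], or [f] is at most its [a]-th
    power times [c = expR (- ((a - 1) * eps))]. The sum of the two bounds is integrated over [S]. *)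
Lemma le_of_density d (T : measurableType d) (R : realType)
    (mu : set T -> \bar R) (nu : {measure set T -> \bar R}) (f : T -> R) (a r eps : R) :
  1 < a -> is_density mu nu f ->
  (\int[nu]_x (f x `^ a)%:E <= (expR (a * (a - 1) * r))%:E)%E ->
  forall S, measurable S ->
  (mu S <= (expR eps)%:E * nu S + (expR ((a - 1) * (a * r - eps)))%:E)%E.
Proof.
move=> a1 [mf f0 muf] Ile S mS; rewrite muf//.
have a0 : 0 < a by rewrite (lt_trans ltr01).
set c := expR (- ((a - 1) * eps)).
have c0 : 0 <= c by exact: expR_ge0.
have mfa : measurable_fun setT (fun x => f x `^ a).
  exact: (@measurableT_comp _ _ _ _ _ _ (@powR R ^~ a)).
have mfaS : measurable_fun S (fun x => (f x `^ a)%:E).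
  by apply: measurable_funTS; exact/measurable_EFinP.
apply: (@le_trans _ _ (\int[nu]_(x in S) ((expR eps)%:E + c%:E * (f x `^ a)%:E))%E).
  apply: ge0_le_integral => //.
  - by move=> x _; rewrite lee_fin.
  - by apply: measurable_funTS; exact/measurable_EFinP.
  - by apply: emeasurable_funD => //; apply: emeasurable_funM.
  move=> x _; rewrite -EFinM -EFinD lee_fin.
  have [fle|fgt] := leP (f x) (expR eps).
    by rewrite (le_trans fle)// lerDl mulr_ge0// powR_ge0.
  have f_gt0 : 0 < f x by rewrite (lt_trans (expR_gt0 _) fgt).
  have -> : f x `^ a = f x `^ (a - 1) * f x.
    rewrite -[X in _ * X]powRr1// -powRD ?subrK//.
    by rewrite (gt_eqF f_gt0) implybT.
  apply: (@le_trans _ _ (c * (f x `^ (a - 1) * f x))); last by rewrite lerDr expR_ge0.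
  rewrite mulrA ler_pMl//.
  have : expR eps `^ (a - 1) <= f x `^ (a - 1).
    by apply: ge0_ler_powR; rewrite ?nnegrE ?expR_ge0 ?subr_ge0//; exact: ltW.
  rewrite -expRM => h; apply: le_trans (ler_wpM2l c0 h).
  by rewrite /c -expRD [X in expR X](_ : _ = 0) ?expR0//; ring.
rewrite ge0_integralD//; last 2 first.
- by move=> x _; rewrite -EFinM lee_fin mulr_ge0// powR_ge0.
- by apply: emeasurable_funM.
rewrite integral_cst//; apply: leeD2l.
rewrite ge0_integralZl//; last by move=> x _; rewrite lee_fin powR_ge0.
have -> : expR ((a - 1) * (a * r - eps)) = c * expR (a * (a - 1) * r).
  by rewrite /c -expRD; congr expR; ring.
rewrite EFinM; apply: lee_wpmul2l; first by rewrite lee_fin.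
apply: le_trans Ile; apply: ge0_subset_integral => //.
- exact/measurable_EFinP.
- by move=> x _; rewrite lee_fin powR_ge0.
Qed.

(** * Independent noise *)

Section noise_space.
Context {R : realType} {I : choiceType}.

Definition cylinders : set (set (I -> R)) :=
  [set A | exists (s : seq I) (B : I -> set R), (forall i, measurable (B i)) /\
     A = [set x | forall i, i \in s -> B i (x i)]].

(** The product sigma-algebra on [I -> R]. On this space some coordinates of the noise can be
    exchanged for those of an independent copy, which is how independence is used throughout. *)
Definition noise := g_sigma_algebraType cylinders.

Lemma measurable_cylinder (s : seq I) (B : I -> set R) :
  (forall i, measurable (B i)) ->
  measurable ([set x | forall i, i \in s -> B i (x i)] : set noise).
Proof. by move=> mB; apply: sub_sigma_algebra; exists s, B. Qed.

Lemma measurable_coord (i : I) : measurable_fun [set: noise] (fun x : noise => x i).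
Proof.
move=> _ B mB; rewrite setTI; apply: sub_sigma_algebra.
exists [:: i], (fun=> B); split => //; apply/seteqP; split => x /=.
  by move=> Bx j; rewrite inE => /eqP ->.
by apply; rewrite inE.
Qed.

Lemma measurable_to_noise d (S : measurableType d) (X : S -> noise) :
  (forall i, measurable_fun [set: S] (fun s => X s i)) -> measurable_fun [set: S] X.
Proof.
move=> mX; apply: (@measurability _ _ S noise setT X cylinders) => // _ [_ [s [B [mB ->]]] <-].
rewrite setTI (_ : X @^-1` _ = \bigcap_(i in [set` s]) ((fun t => X t i) @^-1` B i)).
  apply: fin_bigcap_measurable => // i _.
  by rewrite -[X in measurable X]setTI; exact: mX.
by apply/seteqP; split => x /= h i; exact: h.
Qed.

Definition splice (A : pred I) (x y : noise) : noise :=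
  fun i => if A i then y i else x i.

Lemma measurable_splice (A : pred I) :
  measurable_fun [set: noise * noise] (fun z => splice A z.1 z.2).
Proof.
apply: measurable_to_noise => i; rewrite /splice; case: (A i).
  exact: (measurableT_comp (measurable_coord i)).
exact: (measurableT_comp (measurable_coord i)).
Qed.

Definition independent_coords (L : set noise -> \bar R) :=
  forall (s : seq I) (B : I -> set R), uniq s -> (forall i, measurable (B i)) ->
  L [set x | forall i, i \in s -> B i (x i)] = (\prod_(i <- s) L [set x | B i (x i)])%E.

Section law.
Variable L : probability noise R.
Hypothesis L_indep : independent_coords L.

(** It suffices to compare on cylinders, a pi-system. There independence splits the product over the
    coordinates into those in [A], read from the second copy, and those outside, read from the
    first. *)
Lemma splice_law (A : pred I) (D : set noise) : measurable D ->
  (L \x L)%E ((fun z => splice A z.1 z.2) @^-1` D) = L D.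
Proof.
move=> mD.
pose X : {mfun (noise * noise)%type >-> noise} := mfun_Sub (mem_set (measurable_splice A)).
apply: (@measure_unique _ R noise cylinders (fun=> setT) _ _ _ _
   (distribution (L \x L)%E X) L) => //=.
- move=> _ _ [s [B [mB ->]]] [s' [B' [mB' ->]]].
  exists (s ++ s'), (fun i => (if i \in s then B i else setT) `&` (if i \in s' then B' i else setT)).
  split; first by move=> i; apply: measurableI; case: ifP.
  apply/seteqP; split => x /=.
    by move=> [h h'] i; rewrite mem_cat; split; case: ifPn => // ?; [exact: h|exact: h'].
  by move=> h; split => i si; have := h i; rewrite mem_cat si ?orbT => /(_ isT)[].
- by move=> _; exists [::], (fun=> setT); split => //; apply/seteqP; split.
- by rewrite bigcup_const.
- move=> _ [s0 [B [mB ->]]].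
  pose s := undup s0.
  have -> : [set x : noise | forall i, i \in s0 -> B i (x i)] = [set x | forall i, i \in s -> B i (x i)].
    by apply/seteqP; split => x /= h i; move: (h i); rewrite mem_undup.
  rewrite L_indep ?undup_uniq//.
  rewrite /distribution /pushforward/=.
  pose C (Q : pred I) := [set x : noise | forall i, i \in [seq k <- s | Q k] -> B i (x i)].
  transitivity (L (C (predC A)) * L (C A))%E.
    rewrite -product_measure1E; [|exact: measurable_cylinder..].
    congr (product_measure1 _ _ _); apply/seteqP; split => [[x y]|[x y]] /=.
      move=> h; split => i; rewrite mem_filter => /andP[/= Ai si]; have := h i si;
      by rewrite /splice ?Ai ?(negbTE Ai).
    move=> [hx hy] i si; rewrite /splice; case: ifPn => Ai.
      by apply: hy; rewrite mem_filter Ai.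
    by apply: hx; rewrite mem_filter /= Ai.
  rewrite !L_indep ?filter_uniq ?undup_uniq//.
  by rewrite !big_filter [RHS](bigID A)/= muleC.
- move=> _; exact: le_lt_trans (probability_le1 (distribution (L \x L)%E X) measurableT) (ltry _).
Qed.

(** Fubini's theorem in the role of conditioning on the coordinates outside [A]. *)
Lemma integral_splice (A : pred I) (Psi : noise -> \bar R) :
  measurable_fun [set: noise] Psi -> (forall x, 0 <= Psi x)%E ->
  (\int[L]_x Psi x = \int[L]_x \int[L]_y Psi (splice A x y))%E.
Proof.
move=> mPsi Psi0.
pose X : {mfun (noise * noise)%type >-> noise} := mfun_Sub (mem_set (measurable_splice A)).
transitivity (\int[distribution (L \x L)%E X]_x Psi x)%E.
  by apply: eq_measure_integral => D mD _; exact/esym/splice_law.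
rewrite ge0_integral_distribution// fubini_tonelli1//.
- exact: (measurableT_comp mPsi (measurable_splice A)).
- by move=> z; exact: Psi0.
Qed.

Definition coord_density (i : I) (pi : R -> R) :=
  [/\ measurable_fun [set: R] pi, (forall t, 0 <= pi t) &
      forall B, measurable B ->
        L [set x | B (x i)] = (\int[lebesgue_measure]_(t in B) (pi t)%:E)%E].

Lemma integral_coord (i : I) (pi : R -> R) (g : R -> \bar R) : coord_density i pi ->
  measurable_fun [set: R] g -> (forall t, 0 <= g t)%E ->
  (\int[L]_x g (x i) = \int[lebesgue_measure]_t (g t * (pi t)%:E))%E.
Proof.
move=> [mpi pi0 Lpi] mg g0.
pose X : {mfun noise >-> measurableTypeR R} :=
  @mfun_Sub _ _ noise (measurableTypeR R) (fun x => x i) (mem_set (measurable_coord i)).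
transitivity (\int[distribution L X]_x g x)%E.
  by rewrite ge0_integral_distribution.
exact: (@integral_density _ (measurableTypeR R) R (distribution L X) lebesgue_measure pi mpi pi0 Lpi g mg g0).
Qed.

Definition shift1 (i : I) (m : R) (x : noise) : noise :=
  fun j => if j == i then x j + m else x j.

Lemma measurable_shift1 i m : measurable_fun [set: noise] (shift1 i m).
Proof.
apply: measurable_to_noise => j; rewrite /shift1; case: (j == i).
  by apply: measurable_funD => //; exact: measurable_coord.
exact: measurable_coord.
Qed.

(** Once coordinate [i] alone is resampled, the claim is a one-dimensional translation of Lebesgue
    measure; [r] is the likelihood ratio of the translated density to [pi]. *)
Lemma integral_shift1 (i : I) (m : R) (pi r : R -> R) (Psi : noise -> \bar R) :
  coord_density i pi -> measurable_fun [set: R] r -> (forall t, 0 <= r t) ->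
  (forall t, pi (t - m) = r t * pi t) ->
  measurable_fun [set: noise] Psi -> (forall x, 0 <= Psi x)%E ->
  (\int[L]_x Psi (shift1 i m x) = \int[L]_x (Psi x * (r (x i))%:E))%E.
Proof.
move=> dpi mr r0 piE mPsi Psi0.
rewrite (integral_splice (pred1 i)) //; last exact: (measurableT_comp mPsi (measurable_shift1 i m)).
rewrite [RHS](integral_splice (pred1 i)) //; last 2 first.
- apply: emeasurable_funM => //; apply/measurable_EFinP.
  exact: (measurableT_comp mr (measurable_coord i)).
- by move=> x; rewrite mule_ge0// lee_fin.
apply: eq_integral => x _.
pose g (t : R) : \bar R := Psi (fun j => if j == i then t else x j).
have mg : measurable_fun setT g.
  apply: (measurableT_comp mPsi); apply: measurable_to_noise => j.
  by case: (j == i) => //; exact: measurable_cst.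
have g0 t : (0 <= g t)%E by exact: Psi0.
transitivity (\int[L]_y g (y i + m)%R)%E.
  apply: eq_integral => y _; congr Psi; apply/funext => j.
  by rewrite /shift1 /splice /=; case: eqP => // ->.
transitivity (\int[L]_y (g (y i) * (r (y i))%:E))%E; last first.
  apply: eq_integral => y _; rewrite /splice /= eqxx; congr (Psi _ * _)%E.
  by apply/funext => j; case: eqP => // ->.
have mgm : measurable_fun [set: R] (fun t : R => g (t + m)).
  by apply: (measurableT_comp mg); exact: measurable_funD.
have [mpi pi0 _] := dpi.
rewrite (integral_coord dpi mgm)//.
rewrite (@integral_coord _ _ (fun t : R => g t * (r t)%:E)%E dpi)//; last 2 first.
- by apply: emeasurable_funM => //; exact/measurable_EFinP.
- by move=> t; rewrite mule_ge0// lee_fin.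
rewrite -(@ge0_integral_shift R (- m)); last 2 first.
- by apply: emeasurable_funM => //; exact/measurable_EFinP.
- by move=> t; rewrite mule_ge0// lee_fin.
by apply: eq_integral => t _; rewrite subrK piE -muleA EFinM.
Qed.

End law.
End noise_space.

(** * Private mechanisms in dual form *)

Section mechanisms.
Context {R : realType} {I : choiceType}.
Local Notation noise := (@noise R I).
Variable L : probability noise R.
Hypothesis L_indep : independent_coords L.

(* Freezing the coordinates in [A] turns [U (N x) x] into the iterated integral of
   [U (N x) y] over independent [x] and [y]. *)
Lemma adaptive_composition (A : pred I) d (Z : measurableType d) (N N' : noise -> Z)
    (U U' : Z -> noise -> \bar R) (th c1 c2 : R) : 0 <= c2 ->
  measurable_fun [set: noise] N -> measurable_fun [set: noise] N' ->
  (forall x y, (forall i, A i -> x i = y i) -> N x = N y) ->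
  (forall x y, (forall i, A i -> x i = y i) -> N' x = N' y) ->
  measurable_fun [set: Z * noise] (fun zx => U zx.1 zx.2) ->
  measurable_fun [set: Z * noise] (fun zx => U' zx.1 zx.2) ->
  (forall z x, 0 <= U z x)%E -> (forall z x, 0 <= U' z x)%E ->
  (forall z x y, (forall i, ~~ A i -> x i = y i) -> U z x = U z y) ->
  (forall z x y, (forall i, ~~ A i -> x i = y i) -> U' z x = U' z y) ->
  (forall z, \int[L]_x (U z x `^ th) <= c2%:E * (\int[L]_x U' z x) `^ th)%E ->
  (forall G : Z -> \bar R, measurable_fun [set: Z] G -> (forall z, 0 <= G z)%E ->
    \int[L]_x (G (N x) `^ th) <= c1%:E * (\int[L]_x G (N' x)) `^ th)%E ->
  (\int[L]_x (U (N x) x `^ th) <= (c1 * c2)%:E * (\int[L]_x U' (N' x) x) `^ th)%E.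
Proof.
move=> c20 mN mN' NA N'A mU mU' U0 U'0 UA U'A HU HN.
have mUth : measurable_fun [set: Z * noise] (fun zx => U zx.1 zx.2 `^ th)%E.
  by apply: (@measurableT_comp _ _ _ _ _ _ (fun x : \bar R => x `^ th)%E) => //; exact: measurable_poweR.
have spl V (M : noise -> Z) :
    measurable_fun setT M -> (forall x y, (forall i, A i -> x i = y i) -> M x = M y) ->
    measurable_fun [set: Z * noise] (fun zx => V zx.1 zx.2) ->
    (forall z x, 0 <= V z x)%E ->
    (forall z x y, (forall i, ~~ A i -> x i = y i) -> V z x = V z y) ->
    (\int[L]_x V (M x) x = \int[L]_x \int[L]_y V (M x) y)%E.
  move=> mM MA mV V0 VA; rewrite (integral_splice L_indep (predC A)) //; last first.
    apply: (measurableT_comp mV (_ : measurable_fun setT (fun x => (M x, x)))).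
    exact: measurable_fun_pair.
  apply: eq_integral => x _; apply: eq_integral => y _.
  rewrite (_ : M (splice (predC A) x y) = M x); last first.
    by apply: MA => i Ai; rewrite /splice /= Ai.
  by apply: VA => i Ai; rewrite /splice /= Ai.
rewrite (spl (fun z x => U z x `^ th)%E N)//; last 2 first.
- by move=> z x; exact: poweR_ge0.
- by move=> z x y h; rewrite (UA z x y).
rewrite (spl U' N')//.
(* The expectation over the second stage as a function of the intermediate result: the test function
   at which the first-stage bound [HN] is used. *)
pose G z := (\int[L]_y U' z y)%E.
have mG : measurable_fun [set: Z] G.
  exact: (@measurable_fun_fubini_tonelli_F _ _ _ _ _ L (fun zx : Z * noise => U' zx.1 zx.2)).
have G0 z : (0 <= G z)%E by exact: integral_ge0.
have mGth : measurable_fun [set: Z] (fun z => G z `^ th)%E.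
  by apply: (@measurableT_comp _ _ _ _ _ _ (fun x : \bar R => x `^ th)%E) => //; exact: measurable_poweR.
have mGN : measurable_fun [set: noise] (fun x => G (N x) `^ th)%E by exact: (measurableT_comp mGth mN).
apply: (@le_trans _ _ (\int[L]_x (c2%:E * (G (N x) `^ th)))%E).
  apply: ge0_le_integral => //.
  - by move=> x _; apply: integral_ge0 => y _; exact: poweR_ge0.
  - pose F z := (\int[L]_y (U z y `^ th))%E.
    have mF : measurable_fun setT F.
      by apply: (@measurable_fun_fubini_tonelli_F _ _ _ _ _ L (fun zx : Z * noise => U zx.1 zx.2 `^ th)%E) => // z; exact: poweR_ge0.
    exact: (measurableT_comp mF mN).
  - exact: emeasurable_funM.
rewrite ge0_integralZl//; last by move=> x _; exact: poweR_ge0.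
rewrite mulrC EFinM -muleA; apply: lee_wpmul2l; first by rewrite lee_fin.
exact: HN.
Qed.

(** * Gaussian noise: translating several coordinates *)

Definition shift_coords (s : seq I) (m : I -> R) (x : noise) : noise :=
  fun j => if j \in s then x j + m j else x j.

Lemma measurable_shift_coords s m : measurable_fun [set: noise] (shift_coords s m).
Proof.
apply: measurable_to_noise => j; rewrite /shift_coords; case: (j \in s).
  by apply: measurable_funD => //; exact: measurable_coord.
exact: measurable_coord.
Qed.

(** The likelihood ratio of N(m, 1) to N(0, 1) at [t]. *)
Definition gauss_ratio (m t : R) : R := expR (m * t - m ^+ 2 / 2).

Lemma normal_pdf_shift (m t : R) :
  normal_pdf 0 1 (t - m) = gauss_ratio m t * normal_pdf 0 1 t.
Proof.
rewrite normal_pdfE ?oner_eq0// mulrCA; congr (_ * _).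
by rewrite /normal_fun /gauss_ratio -expRD; congr expR; field.
Qed.

Lemma measurable_gauss_ratio (m : R) : measurable_fun [set: R] (gauss_ratio m).
Proof.
apply: measurableT_comp; first exact: measurable_expR.
by apply: measurable_funB => //; exact: measurable_funM.
Qed.

Lemma measurable_prod_gauss_ratio (s : seq I) (m : I -> R) :
  measurable_fun [set: noise] (fun x => \prod_(i <- s) gauss_ratio (m i) (x i)).
Proof.
elim: s => [|i s ih].
  rewrite (_ : (fun x : noise => _) = cst 1); first exact: measurable_cst.
  by apply/funext => x; rewrite big_nil.
rewrite (_ : (fun x : noise => _) = (fun x : noise =>
    gauss_ratio (m i) (x i) * \prod_(j <- s) gauss_ratio (m j) (x j))); last first.
  by apply/funext => x; rewrite big_cons.
apply: measurable_funM => //.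
exact: (measurableT_comp (measurable_gauss_ratio (m i)) (measurable_coord i)).
Qed.

Section gaussian.
Variable s : seq I.
Hypothesis s_uniq : uniq s.
Hypothesis s_normal : forall i, i \in s -> coord_density L i (normal_pdf 0 1).

(** Induction on [s], one coordinate at a time; as [s] has no repetition, the remaining shifts leave
    the ratio of coordinate [i] unchanged. *)
Lemma integral_shift_gauss (m : I -> R) (Psi : noise -> \bar R) :
  measurable_fun [set: noise] Psi -> (forall x, 0 <= Psi x)%E ->
  (\int[L]_x Psi (shift_coords s m x) =
   \int[L]_x (Psi x * (\prod_(i <- s) gauss_ratio (m i) (x i))%:E))%E.
Proof.
elim: s s_uniq s_normal Psi => [|i s' ih] /= us ns Psi mPsi Psi0.
  by apply: eq_integral => x _; rewrite big_nil mule1.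
move: us => /andP[is' us'].
have shE x : shift_coords (i :: s') m x = shift_coords s' m (shift1 i (m i) x).
  apply/funext => j; rewrite /shift_coords /shift1 inE.
  by case: eqP => //= ->; rewrite (negbTE is').
transitivity (\int[L]_x (Psi (shift_coords s' m x) * (gauss_ratio (m i) (x i))%:E))%E.
  under eq_integral do rewrite shE.
  apply: (@integral_shift1 _ _ L L_indep i (m i) (normal_pdf 0 1) (gauss_ratio (m i))
    (fun x => Psi (shift_coords s' m x))).
  - by apply: ns; rewrite inE eqxx.
  - exact: measurable_gauss_ratio.
  - by move=> t; exact: expR_ge0.
  - by move=> t; rewrite normal_pdf_shift.
  - exact: (measurableT_comp mPsi (measurable_shift_coords s' m)).
  - by move=> x; exact: Psi0.
pose Psi' x := (Psi x * (gauss_ratio (m i) (x i))%:E)%E.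
transitivity (\int[L]_x Psi' (shift_coords s' m x))%E.
  by apply: eq_integral => x _; rewrite /Psi' /shift_coords (negbTE is').
rewrite ih//; last 3 first.
- by move=> j js; apply: ns; rewrite inE js orbT.
- apply: emeasurable_funM => //; apply/measurable_EFinP.
  exact: (measurableT_comp (measurable_gauss_ratio (m i)) (measurable_coord i)).
- by move=> x; rewrite mule_ge0// lee_fin expR_ge0.
by apply: eq_integral => x _; rewrite /Psi' -muleA -EFinM big_cons.
Qed.

(** The shift becomes the weight [f], a product of likelihood ratios. Hoelder's inequality asks for
    its moment of order [a], which is [exp (a * (a - 1) / 2 * S)] with [S] the sum of the squared
    shifts. *)
Lemma gaussian_dual (m : I -> R) (a r : R) (u : noise -> \bar R) :
  1 < a -> \sum_(i <- s) m i ^+ 2 <= 2 * r ->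
  measurable_fun [set: noise] u -> (forall x, 0 <= u x)%E ->
  (\int[L]_x (u (shift_coords s m x) `^ ((a - 1) / a)) <=
   (expR ((a - 1) * r))%:E * (\int[L]_x u x) `^ ((a - 1) / a))%E.
Proof.
move=> a1 mr mu_ u0.
have a0 : 0 < a by rewrite (lt_trans ltr01).
have muth : measurable_fun setT (fun x => u x `^ ((a - 1) / a))%E.
  by apply: (@measurableT_comp _ _ _ _ _ _ (fun x : \bar R => x `^ ((a - 1) / a))%E) => //; exact: measurable_poweR.
rewrite (integral_shift_gauss m muth); last by move=> x; exact: poweR_ge0.
pose f (x : noise) := \prod_(i <- s) gauss_ratio (m i) (x i).
have f0 x : 0 <= f x by apply: prodr_ge0 => i _; exact: expR_ge0.
have -> : expR ((a - 1) * r) = expR (a * (a - 1) * r) `^ a^-1.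
  by rewrite -expRM; congr expR; field; rewrite gt_eqF.
apply: integral_poweR_density => //.
- exact: expR_gt0.
- exact: measurable_prod_gauss_ratio.
(* Completing the square: the [a]-th power of a ratio is a constant times the ratio for the shift
   [a * m i]. *)
have fa x : f x `^ a = expR (a * (a - 1) / 2 * \sum_(i <- s) m i ^+ 2) *
                       \prod_(i <- s) gauss_ratio (a * m i) (x i).
  rewrite /f; elim: (s) => [|i s' ih].
    by rewrite !big_nil powR1 mulr0 expR0 mulr1.
  rewrite !big_cons powRM ?expR_ge0//; last by apply: prodr_ge0 => j _; exact: expR_ge0.
  have -> : gauss_ratio (m i) (x i) `^ a =
      expR (a * (a - 1) / 2 * m i ^+ 2) * gauss_ratio (a * m i) (x i).
    by rewrite /gauss_ratio -expRM -expRD; congr expR; field.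
  by rewrite ih [_ * (m i ^+ 2 + _)]mulrDr expRD; ring.
under eq_integral do rewrite fa EFinM.
rewrite ge0_integralZl//; last 2 first.
- apply/measurable_EFinP; exact: (measurable_prod_gauss_ratio s (fun i => a * m i)).
- by move=> x _; rewrite lee_fin; apply: prodr_ge0 => i _; exact: expR_ge0.
(* The shift formula applied to the constant function 1. *)
have -> : (\int[L]_x (\prod_(i <- s) gauss_ratio (a * m i) (x i))%:E = 1)%E.
  have := integral_shift_gauss (fun i => a * m i) (@measurable_cst _ _ noise (\bar R) setT 1%E) (fun=> lee01).
  under [in RHS]eq_integral do rewrite mul1e.
  by move=> <-; rewrite integral_cst// mul1e; exact: probability_setT.
rewrite mule1 lee_fin ler_expR.
have : 0 <= a * (a - 1) by rewrite mulr_ge0 ?ltW// subr_gt0.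
by move: mr; set S := \sum_(_ <- _) _; nra.
Qed.

End gaussian.

(** * Laplace noise and pure differential privacy *)

(** The likelihood ratio [r] of the translated standard Laplace density is at most [expR eps] by the
    triangle inequality. *)
Lemma laplace_shift_le (i : I) (eps : R) (Psi : noise -> \bar R) : 0 <= eps ->
  coord_density L i (fun t => (2 * 1)^-1 * expR (- `|t| / 1)) ->
  measurable_fun [set: noise] Psi -> (forall x, 0 <= Psi x)%E ->
  (\int[L]_x Psi (shift1 i eps x) <= (expR eps)%:E * \int[L]_x Psi x)%E.
Proof.
move=> e0 di mPsi Psi0.
pose r t := expR (`|t| - `|t - eps|).
have mr : measurable_fun [set: R] r.
  apply: measurableT_comp; first exact: measurable_expR.
  apply: measurable_funB; first exact: normr_measurable.
  apply: measurableT_comp; first exact: normr_measurable.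
  exact: measurable_funB.
rewrite (integral_shift1 L_indep (r := r) di)//; last 2 first.
- by move=> t; exact: expR_ge0.
- by move=> t; rewrite mulrCA /r -expRD; congr (_ * expR _); rewrite !divr1; ring.
rewrite -ge0_integralZl ?lee_fin ?expR_ge0//.
apply: ge0_le_integral => //.
- by move=> x _; rewrite mule_ge0// lee_fin expR_ge0.
- apply: emeasurable_funM => //; apply/measurable_EFinP.
  exact: (measurableT_comp mr (measurable_coord i)).
- exact: emeasurable_funM.
move=> x _; rewrite muleC; apply: lee_wpmul2r => //.
rewrite lee_fin ler_expR.
by have := ler_normD (x i - eps) eps; rewrite subrK (ger0_norm e0); lra.
Qed.

Lemma integral_index (N : noise -> nat) (k : nat) (g : nat -> \bar R) :
  measurable_fun [set: noise] N -> (forall x, (N x < k)%N) ->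
  (forall j, 0 <= g j)%E ->
  (\int[L]_x g (N x) = \sum_(j < k) g j * L [set x | N x = j])%E.
Proof.
move=> mN Nk g0.
have mNj j : measurable [set x : noise | N x = j].
  by have := mN measurableT [set j] Logic.I; rewrite setTI.
have -> : (\int[L]_x g (N x) =
    \int[L]_x (\sum_(j < k) g j * (\1_[set x | N x = j] x)%:E))%E.
  apply: eq_integral => x _; rewrite (bigD1 (Ordinal (Nk x)))//= big1.
    by rewrite adde0 indicE mem_set// mule1.
  move=> j jN; rewrite indicE memNset ?mule0// => /= Nj.
  by move/eqP: jN; apply; apply/val_inj.
rewrite ge0_integral_sum//; last 2 first.
- move=> j; apply: emeasurable_funM => //; apply/measurable_EFinP.
  exact: measurable_indic.
- by move=> j x _; rewrite mule_ge0// lee_fin.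
apply: eq_bigr => j _; rewrite ge0_integralZl//; last first.
  by apply/measurable_EFinP; exact: measurable_indic.
by rewrite integral_indic// setIT.
Qed.

(* The likelihood ratio [f] stays in [[e^-eps, e^eps]] and has mean 1, so replacing
   [t^a] by its chord over this interval bounds its moment of order [a]. *)
Lemma pure_dp_dual (N N' : noise -> nat) (k : nat) (a eps : R) (u : nat -> \bar R) :
  1 < a -> 0 < eps ->
  measurable_fun [set: noise] N -> measurable_fun [set: noise] N' ->
  (forall x, (N x < k)%N) -> (forall x, (N' x < k)%N) ->
  (forall j, L [set x | N x = j] <= (expR eps)%:E * L [set x | N' x = j])%E ->
  (forall j, L [set x | N' x = j] <= (expR eps)%:E * L [set x | N x = j])%E ->
  (forall j, 0 <= u j)%E ->
  (\int[L]_x (u (N x) `^ ((a - 1) / a)) <=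
   (expR ((a - 1) * (eps ^+ 2 / 2)))%:E * (\int[L]_x u (N' x)) `^ ((a - 1) / a))%E.
Proof.
move=> a1 e0 mN mN' Nk N'k NN' N'N u0.
have a0 : 0 < a by rewrite (lt_trans ltr01).
have mNj (M : noise -> nat) j : measurable_fun [set: noise] M -> measurable [set x : noise | M x = j].
  by move=> mM; have := mM measurableT [set j] Logic.I; rewrite setTI.
pose p j := fine (L [set x | N x = j]).
pose q j := fine (L [set x | N' x = j]).
have pE j : L [set x | N x = j] = (p j)%:E by rewrite /p fineK// fin_num_measure//; exact: mNj.
have qE j : L [set x | N' x = j] = (q j)%:E by rewrite /q fineK// fin_num_measure//; exact: mNj.
have p0 j : 0 <= p j by exact: fine_ge0.
have q0 j : 0 <= q j by exact: fine_ge0.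
have pq j : p j <= expR eps * q j by rewrite -lee_fin EFinM -pE -qE.
have qp j : q j <= expR eps * p j by rewrite -lee_fin EFinM -pE -qE.
(* Where [q j = 0] also [p j = 0], so any value serves as ratio there; 1 lies in the required
   interval. *)
pose f j := if q j == 0 then 1 else p j / q j.
have pf j : p j = f j * q j.
  rewrite /f; case: eqP => [qj0|/eqP qj0]; last by rewrite divfK.
  rewrite qj0 mulr0; apply/eqP; rewrite eq_le p0 andbT.
  by have := pq j; rewrite qj0 mulr0.
have fb j : expR (- eps) <= f j <= expR eps.
  rewrite /f; case: eqP => [_|/eqP qj0].
    by rewrite -[1](@expR0 R) !ler_expR; apply/andP; split; lra.
  have qj : 0 < q j by rewrite lt_neqAle eq_sym qj0 q0.
  by rewrite ler_pdivlMr// ler_pdivrMr// pq andbT expRN ler_pdivrMl ?expR_gt0.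
have f0 j : 0 <= f j by have /andP[h _] := fb j; exact: le_trans (expR_ge0 _) h.
have sump : \sum_(j < k) p j = 1.
  apply: EFin_inj; rewrite -sumEFin.
  transitivity (\int[L]_x (cst 1%E (N x)))%E.
    rewrite (integral_index mN Nk)//.
    by apply: eq_bigr => j _; rewrite mul1e pE.
  by rewrite (_ : (fun x => _) = cst 1%E)// integral_cst// mul1e; exact: probability_setT.
have sumq : \sum_(j < k) q j = 1.
  apply: EFin_inj; rewrite -sumEFin.
  transitivity (\int[L]_x (cst 1%E (N' x)))%E.
    rewrite (integral_index mN' N'k)//.
    by apply: eq_bigr => j _; rewrite mul1e qE.
  by rewrite (_ : (fun x => _) = cst 1%E)// integral_cst// mul1e; exact: probability_setT.
have -> : (\int[L]_x (u (N x) `^ ((a - 1) / a)) =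
    \int[L]_x (u (N' x) `^ ((a - 1) / a) * (f (N' x))%:E))%E.
  rewrite (integral_index (g := fun j => u j `^ ((a - 1) / a))%E mN Nk); last first.
    by move=> j; exact: poweR_ge0.
  rewrite (integral_index (g := fun j => u j `^ ((a - 1) / a) * (f j)%:E)%E mN' N'k); last first.
    by move=> j; rewrite mule_ge0 ?poweR_ge0// lee_fin.
  by apply: eq_bigr => j _; rewrite pE qE pf EFinM muleA.
have -> : expR ((a - 1) * (eps ^+ 2 / 2)) = expR (a * (a - 1) * (eps ^+ 2 / 2)) `^ a^-1.
  by rewrite -expRM; congr expR; field; rewrite gt_eqF.
have mg (g : nat -> R) : measurable_fun [set: noise] (fun x => g (N' x)).
  by apply: (measurableT_comp _ mN').
have mge (g : nat -> \bar R) : measurable_fun [set: noise] (fun x => g (N' x)).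
  by apply: (measurableT_comp _ mN').
apply: integral_poweR_density => //; first exact: expR_gt0.
rewrite (integral_index (g := fun j => (f j `^ a)%:E) mN' N'k); last first.
  by move=> j; rewrite lee_fin powR_ge0.
under eq_bigr do rewrite qE -EFinM.
rewrite sumEFin lee_fin; apply: le_trans (chord_at_1_le (ltW a1) e0).
set E := expR eps; set e := expR (- eps); set X := expR (- _); set Y := expR _.
(* The chord is affine in [f j], and both [q] and [p = f * q] sum to 1, so the mean of the chord
   values is the chord at 1. *)
have -> : ((E - 1) * X + (1 - e) * Y) / (E - e) =
    \sum_(j < k) (((E - f j) * X + (f j - e) * Y) / (E - e) * q j).
  under eq_bigr => j _.
    rewrite (_ : _ * q j = (E * X - e * Y) / (E - e) * q j + (Y - X) / (E - e) * p j); last first.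
      by rewrite pf; ring.
    over.
  by rewrite big_split/= -!mulr_sumr sump sumq; ring.
apply: ler_sum => j _; apply: ler_wpM2r => //.
exact: powR_le_chord (ltW a1) e0 (fb j).
Qed.

End mechanisms.

(** * The Borel sets of R^p *)

(** Meant for the branching of a run on the index returned by NoisyMax: the domain is cut into
    countably many pieces by the value of [N]. *)
Lemma measurable_fun_nat_family d d' (S : measurableType d) (T : measurableType d')
    (N : S -> nat) (F : nat -> S -> T) :
  measurable_fun [set: S] N -> (forall j, measurable_fun [set: S] (F j)) ->
  measurable_fun [set: S] (fun s => F (N s) s).
Proof.
move=> mN mF _ B mB; rewrite setTI.
rewrite (_ : _ @^-1` B = \bigcup_j ((N @^-1` [set j]) `&` (F j @^-1` B))).
  apply: bigcup_measurable => j _; apply: measurableI.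
    by have := mN measurableT [set j] I; rewrite setTI.
  by have := mF j measurableT B mB; rewrite setTI.
apply/seteqP; split => [s /= Bs|s [j _ [/= <- Bs]]//].
by exists (N s).
Qed.

Lemma measurable_to_nat d (S : measurableType d) (N : S -> nat) :
  (forall j, measurable [set s | N s = j]) -> measurable_fun [set: S] N.
Proof.
move=> mN _ B _; rewrite setTI.
rewrite (_ : N @^-1` B = \bigcup_(j in B) [set s | N s = j]).
  by apply: bigcup_measurable => j _.
by apply/seteqP; split => [s Bs|s [j Bj /= ->]//]; exists (N s).
Qed.

Section borel_vector.
Context {R : realType} {p : nat}.
Local Notation V := (@out_space R p).

(** An open set is a countable union of balls with rational centre and radius [1 / (n + 1)], and a
    ball of the sup norm is a finite intersection of conditions on single coordinates. *)
Lemma measurable_to_out_space d (S : measurableType d) (X : S -> V) :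
  (forall j, measurable_fun [set: S] (fun s => (X s : 'rV[R]_p) 0 j)) ->
  measurable_fun [set: S] X.
Proof.
move=> mX; apply: (@measurability _ _ S V setT X (@open 'rV[R]_p)) => // _ [U oU <-].
rewrite setTI.
pose c (q : 'rV[rat]_p) : 'rV[R]_p := \row_j ratr (q 0 j).
pose D (qn : 'rV[rat]_p * nat) : set S :=
  if asbool (ball (c qn.1) (qn.2.+1%:R^-1 : R) `<=` U) then
    X @^-1` (ball (c qn.1) (qn.2.+1%:R^-1 : R) : set 'rV[R]_p) else set0.
rewrite (_ : X @^-1` U = \bigcup_qn D qn); last first.
  apply/seteqP; split => [s /= Us|s [qn _]]; last first.
    by rewrite /D; case: asboolP => // /[apply].
  have /nbhs_ballP[e /= e0 eU] : nbhs (X s : 'rV[R]_p) U by exact: open_nbhs_nbhs.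
  (* A radius below [e / 2] keeps the ball around a rational centre close to [X s] inside the ball
     of radius [e] around [X s]. *)
  have [n ne] : exists n : nat, (n.+1%:R^-1 : R) < e / 2.
    have e20 : 0 < e / 2 by rewrite divr_gt0.
    exists (Num.truncn (e / 2)^-1).
    by rewrite -[ltRHS]invrK ltf_pV2 ?posrE ?invr_gt0// truncnS_gt.
  have qP j : exists q : rat, `|ratr q - (X s : 'rV[R]_p) 0 j| < (n.+1%:R^-1 : R).
    have : 0 < (n.+1%:R^-1 : R) by rewrite invr_gt0.
    move: (n.+1%:R^-1 : R) ((X s : 'rV[R]_p) 0 j) => i x i0.
    have [|q] := @rat_in_itvoo R (x - i) (x + i); first by lra.
    by rewrite in_itv/= => /andP[q1 q2]; exists q; rewrite ltr_norml; apply/andP; split; lra.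
  have [q qq] := choice qP.
  have cX : ball (c (\row_j q j)) (n.+1%:R^-1 : R) (X s : 'rV[R]_p).
    by split => // i j; rewrite (ord1 i) -ball_normE /= !mxE; exact: qq.
  exists (\row_j q j, n) => //; rewrite /D asboolT//=.
  move=> y cy; apply: eU.
  have -> : e = e / 2 + e / 2 by rewrite -splitr.
  apply: (@ball_triangle _ _ (c (\row_j q j))).
    by apply: ball_sym; apply: le_ball cX; exact: ltW.
  by apply: le_ball cy; exact: ltW.
apply: countable_bigcupT_measurable => //.
move=> [q n]; rewrite /D; case: asboolP => // _ /=.
rewrite (_ : _ @^-1` _ = \bigcap_(j in [set: 'I_p]) [set s | `|ratr (q 0 j) - (X s : 'rV[R]_p) 0 j| < n.+1%:R^-1]).
  apply: fin_bigcap_measurable => // j _.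
  have mN : measurable_fun [set: S] (fun s => `|ratr (q 0 j) - (X s : 'rV[R]_p) 0 j|).
    apply: measurableT_comp; first exact: normr_measurable.
    by apply: measurable_funB.
  have := measurable_fun_ltr mN (@measurable_cst _ _ S R setT n.+1%:R^-1).
  by move=> /(_ measurableT [set true] I); rewrite setTI.
apply/seteqP; split => s /=.
  by move=> [_ h] j _; have := h 0 j; rewrite -ball_normE /= !mxE.
by move=> h; split => // i j; rewrite -ball_normE /= !mxE (ord1 i); exact: h.
Qed.

Lemma measurable_continuous_comp d (S : measurableType d) (X : S -> V) (f : 'rV[R]_p -> R) :
  continuous f -> measurable_fun [set: S] X -> measurable_fun [set: S] (fun s => f (X s)).
Proof.
move=> cf mX; apply: (@measurableT_comp _ _ _ _ _ _ (f : V -> R)) => //.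
apply: (measurability _ (RGenOInfty.measurableE R)) => // _ [_ [x ->] <-].
rewrite setTI; apply: sub_sigma_algebra.
by apply: open_comp => // y _; exact: cf.
Qed.

Lemma measurable_coord_vec d (S : measurableType d) (X : S -> V) (j : 'I_p) :
  measurable_fun [set: S] X -> measurable_fun [set: S] (fun s => (X s : 'rV[R]_p) 0 j).
Proof. exact: (@measurable_continuous_comp _ _ _ (fun w => w 0 j) (@coord_continuous _ _ _ _ _)). Qed.

Lemma measurable_vecD d (S : measurableType d) (X Y : S -> 'rV[R]_p) :
  measurable_fun [set: S] (X : S -> V) -> measurable_fun [set: S] (Y : S -> V) ->
  measurable_fun [set: S] ((fun s => X s + Y s) : S -> V).
Proof.
move=> mX mY; apply: measurable_to_out_space => j.
rewrite (_ : (fun s => _) = (fun s => X s 0 j + Y s 0 j)); last by apply/funext => s; rewrite mxE.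
by apply: measurable_funD; [exact: measurable_coord_vec mX|exact: measurable_coord_vec mY].
Qed.

Lemma measurable_vecZ d (S : measurableType d) (a : S -> R) (X : S -> 'rV[R]_p) :
  measurable_fun [set: S] a -> measurable_fun [set: S] (X : S -> V) ->
  measurable_fun [set: S] ((fun s => a s *: X s) : S -> V).
Proof.
move=> ma mX; apply: measurable_to_out_space => j.
rewrite (_ : (fun s => _) = (fun s => a s * X s 0 j)); last by apply/funext => s; rewrite mxE.
by apply: measurable_funM => //; exact: measurable_coord_vec mX.
Qed.

(** The gradient may be discontinuous, but its components are limits of difference quotients with
    increments [1 / (n + 1)], measurable because [f] is continuous. *)
Lemma measurable_grad d (S : measurableType d) (f : 'rV[R]_p -> R) (X : S -> 'rV[R]_p) :
  (forall w, differentiable f w) -> measurable_fun [set: S] (X : S -> V) ->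
  measurable_fun [set: S] ((fun s => grad f (X s)) : S -> V).
Proof.
move=> df mX; apply: measurable_to_out_space => j.
rewrite (_ : (fun s => _) = (fun s => 'D_(delta_mx 0 j) f (X s))); last first.
  by apply/funext => s; rewrite mxE.
have cf : continuous f by move=> w; exact: differentiable_continuous.
pose h (n : nat) (s : S) : R := (n.+1%:R^-1)^-1 *: (f (n.+1%:R^-1 *: delta_mx 0 j + X s) - f (X s)).
apply: (measurable_fun_cvg (h := h)).
- move=> n; apply: measurable_funM => //; apply: measurable_funB.
    apply: measurable_continuous_comp => //; apply: measurable_vecD => //.
  exact: measurable_continuous_comp.
- move=> s _; have /cvg_ex[l hl] := @diff_derivable _ _ _ f (X s) (delta_mx 0 j) (df (X s)).
  rewrite /derive (cvg_lim _ hl)//.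
  move/cvgr_dnbhsP : hl => /(_ (fun n => n.+1%:R^-1)); apply; split.
    by move=> n; rewrite invr_eq0 pnatr_eq0.
  exact: cvg_harmonic.
Qed.

End borel_vector.

(** * NoisyMax and the run of the algorithm *)

Section argmax.
Context {R : realType}.

Lemma argmax_first_spec (s : seq R) : (0 < size s)%N ->
  (argmax_first s < size s)%N /\
  forall l, (l < size s)%N -> nth 0 s l <= nth 0 s (argmax_first s) /\
    ((l < argmax_first s)%N -> nth 0 s l < nth 0 s (argmax_first s)).
Proof.
rewrite /argmax_first; case: (size s) => // m _.
elim: m => [|m]; first by rewrite /= ltxx; split => // -[|l].
rewrite -[m.+2]addn1 iotaD foldl_cat add0n /=.
set b := foldl _ _ _ => -[bm ih]; case: ltP => h; split.
- by rewrite addn1.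
- move=> l; rewrite addn1 ltnS leq_eqVlt => /orP[/eqP ->|lm].
    by rewrite ltnn.
  by have [l1 l2] := ih l lm; split => [|_]; [exact/ltW/(le_lt_trans l1)|exact: le_lt_trans h].
- by rewrite addn1 ltnS ltnW.
- move=> l; rewrite addn1 ltnS leq_eqVlt => /orP[/eqP ->|lm]; last exact: ih.
  by split => // mb; move: bm; rewrite ltnNge ltnW.
Qed.

Lemma argmax_first_eq (s : seq R) (j : nat) : (j < size s)%N ->
  (forall l, (l < size s)%N -> nth 0 s l <= nth 0 s j /\
    ((l < j)%N -> nth 0 s l < nth 0 s j)) ->
  argmax_first s = j.
Proof.
move=> js h; have [bs hb] := argmax_first_spec (leq_ltn_trans (leq0n _) js).
have [j1 j2] := hb j js; have [b1 b2] := h _ bs.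
case: (ltngtP (argmax_first s) j) => // lt.
  by move: (b2 lt); rewrite ltNge j1.
by move: (j2 lt); rewrite ltNge b1.
Qed.

Lemma measurable_argmax_first d (S : measurableType d) (y : nat -> S -> R) (m : nat) :
  (forall l, measurable_fun [set: S] (y l)) ->
  measurable_fun [set: S] (fun s => argmax_first [seq y l s | l <- iota 0 m]).
Proof.
move=> my; case: m => [|m]; first exact: measurable_cst.
pose ys s := [seq y l s | l <- iota 0 m.+1].
have szE s : size (ys s) = m.+1 by rewrite size_map size_iota.
have ysE s l : (l < m.+1)%N -> nth 0 (ys s) l = y l s.
  by move=> lm; rewrite (nth_map 0%N) ?size_iota// nth_iota.
apply: measurable_to_nat => j.
have [jm|mj] := ltnP j m.+1; last first.
  rewrite [X in measurable X](_ : _ = set0)//.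
  apply/seteqP; split => s //= h; have [] := @argmax_first_spec (ys s); rewrite szE//.
  by rewrite h ltnNge mj.
rewrite (_ : [set s | _] = \bigcap_(l in [set l | (l < m.+1)%N])
   ([set s | y l s <= y j s] `&` [set s | (l < j)%N ==> (y l s < y j s)])).
  apply: bigcap_measurableType => l _; apply: measurableI.
    have := measurable_fun_ler (my l) (my j).
    by move=> /(_ measurableT [set true] I); rewrite setTI.
  case: (l < j)%N => /=; last by rewrite [X in measurable X](_ : _ = setT)//; apply/seteqP; split.
  have := measurable_fun_ltr (my l) (my j).
  by move=> /(_ measurableT [set true] I); rewrite setTI.
apply/seteqP; split => s /=.
  move=> h l /= lm; have [_ /(_ l)] := @argmax_first_spec (ys s) ltac:(by rewrite szE).
  rewrite szE h !ysE// => /(_ lm)[h1 h2]; split => //.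
  exact/implyP.
move=> h; apply: (@argmax_first_eq (ys s)); rewrite szE// => l lm.
by have [/= h1 /implyP h2] := h l lm; rewrite !ysE.
Qed.

(* Raising the winning score by [Delta] compensates every change of the scores
   in which any two scores move apart by at most [Delta]. *)
Lemma noisy_max_shift (vals vals' : seq R) (Delta eps : R) (lap : nat -> R) (j : nat) :
  0 < Delta -> 0 < eps -> (0 < size vals)%N -> size vals' = size vals ->
  (forall l l', (l < size vals)%N -> (l' < size vals)%N ->
     (nth 0 vals' l - nth 0 vals l) - (nth 0 vals' l' - nth 0 vals l') <= Delta) ->
  noisy_max vals Delta eps lap = j ->
  noisy_max vals' Delta eps (fun l => if l == j then lap l + eps else lap l) = j.
Proof.
move=> D0 e0 v0 sz close; rewrite /noisy_max.
set s := [seq _ | _ <- _] => jE.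
have szs : size s = size vals by rewrite size_map size_iota.
have sE l : (l < size vals)%N -> nth 0 s l = nth 0 vals l + Delta / eps * lap l.
  by move=> lm; rewrite (nth_map 0%N) ?size_iota// nth_iota.
have [] := @argmax_first_spec s; rewrite szs// jE => js hj.
apply: argmax_first_eq; rewrite size_map size_iota sz// => l lm.
have [h1 h2] := hj l lm.
rewrite !(nth_map 0%N) ?size_iota ?sz// !nth_iota ?sz// !add0n eqxx.
move: h1 h2; rewrite !sE//.
have [->|lj] := eqVneq l j; first by rewrite ltnn.
have := close l j lm js.
(* The noise is scaled by [Delta / eps], so adding [eps] to the standard Laplace variable raises the
   noisy score by exactly [Delta]. *)
have : Delta / eps * (lap j + eps) = Delta / eps * lap j + Delta by field; rewrite gt_eqF.
set A := Delta / eps * (lap j + eps); set B := Delta / eps * lap j.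
set E := Delta / eps * lap l => -> c h1 h2; split => [|/h2]; lra.
Qed.

End argmax.

(** * Measurability, noise dependence and sensitivity of the algorithm *)

Section algorithm.
Context {R : realType} {p : nat}.
Local Notation V := (@out_space R p).
Local Notation record := ('rV[R]_p * R)%type.
Variables (loss : 'rV[R]_p -> record -> R) (reg : 'rV[R]_p -> R).
Hypothesis loss_ge0 : forall w r, 0 <= loss w r.
Hypothesis loss_diff : forall r w, differentiable (loss^~ r) w.
Hypothesis reg_diff : forall w, differentiable reg w.
Variables (rho_nmax gamma C_obj C_grad : R) (steps : seq R -> seq R).

Lemma measurable_inv_ge0 d (S : measurableType d) (f : S -> R) :
  (forall s, 0 <= f s) -> measurable_fun [set: S] f ->
  measurable_fun [set: S] (fun s => (f s)^-1).
Proof.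
move=> f0 mf; rewrite (_ : (fun s => _) = (fun s => f s `^ (-1))); last first.
  by apply/funext => s; rewrite powR_inv1.
exact: (@measurableT_comp _ _ _ _ _ _ (@powR R ^~ (-1))).
Qed.

Lemma measurable_norm2 d (S : measurableType d) (X : S -> 'rV[R]_p) :
  measurable_fun [set: S] (X : S -> V) -> measurable_fun [set: S] (fun s => norm2 (X s)).
Proof.
move=> mX; pose f s := \sum_(j < p) X s 0 j ^+ 2.
rewrite (_ : (fun s => _) = (fun s => f s `^ 2^-1)); last first.
  by apply/funext => s; rewrite powR12_sqrt// sumr_ge0// => j _; exact: sqr_ge0.
apply: (@measurableT_comp _ _ _ _ _ _ (@powR R ^~ 2^-1)) => //.
apply: measurable_sum => j; apply: measurable_funX.
exact: measurable_coord_vec mX.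
Qed.

Lemma measurable_clipped_grad_sum d (S : measurableType d) (D : seq record) (W : S -> 'rV[R]_p) :
  measurable_fun [set: S] (W : S -> V) ->
  measurable_fun [set: S] ((fun s => clipped_grad_sum loss C_grad (W s) D) : S -> V).
Proof.
move=> mW; rewrite /clipped_grad_sum; elim: D => [|r D ih].
  rewrite (_ : (fun s => _) = cst 0); first exact: measurable_cst.
  by apply/funext => s; rewrite big_nil.
rewrite (_ : (fun s => _) = (fun s =>
   (Num.max 1 (norm2 (grad (loss^~ r) (W s)) / C_grad))^-1 *: grad (loss^~ r) (W s) +
   \sum_(r <- D) (Num.max 1 (norm2 (grad (loss^~ r) (W s)) / C_grad))^-1 *: grad (loss^~ r) (W s))); last first.
  by apply/funext => s; rewrite big_cons.
apply: measurable_vecD => //; apply: measurable_vecZ; last exact: measurable_grad.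
apply: measurable_inv_ge0; first by move=> s; rewrite le_max ler01.
apply: measurable_maxr => //; apply: measurable_funM => //.
exact/measurable_norm2/measurable_grad.
Qed.

Lemma measurable_noisy_grad d (S : measurableType d) (D : seq record) (W : S -> 'rV[R]_p)
    (gauss : S -> nat -> 'I_p -> R) (sigma : R) (k : nat) :
  measurable_fun [set: S] (W : S -> V) ->
  (forall k j, measurable_fun [set: S] (fun s => gauss s k j)) ->
  measurable_fun [set: S]
    ((fun s => noisy_grad loss reg C_grad D (gauss s) (W s) sigma k) : S -> V).
Proof.
move=> mW mg; rewrite /noisy_grad; apply: measurable_vecD.
  by apply: measurable_vecD; [exact: measurable_clipped_grad_sum|exact: measurable_grad].
apply: measurable_vecZ => //; apply: measurable_to_out_space => j.
by rewrite (_ : (fun s => _) = (fun s => gauss s k j))//; apply/funext => s; rewrite mxE.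
Qed.

(** The list that [run] passes to NoisyMax, named to study its dependence on the database. *)
Definition scores (D : seq record) (Phi : seq R) (w g : 'rV[R]_p) : seq R :=
  [seq - (f_clip loss C_obj (w - a *: g) D + reg (w - a *: g)) | a <- Phi].

Lemma measurable_noisy_max_scores d (S : measurableType d) (D : seq record) (Phi : seq R)
    (W G : S -> 'rV[R]_p) (lap : S -> nat -> R) (Delta eps : R) :
  measurable_fun [set: S] (W : S -> V) -> measurable_fun [set: S] (G : S -> V) ->
  (forall l, measurable_fun [set: S] (lap^~ l)) ->
  measurable_fun [set: S] (fun s => noisy_max (scores D Phi (W s) (G s)) Delta eps (lap s)).
Proof.
move=> mW mG ml.
pose y l s := nth 0 (scores D Phi (W s) (G s)) l + Delta / eps * lap s l.
rewrite (_ : (fun s => _) = (fun s => argmax_first [seq y l s | l <- iota 0 (size Phi)])).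
  apply: measurable_argmax_first => l; apply: measurable_funD; last first.
    exact: measurable_funM.
  have [lP|Pl] := ltnP l (size Phi); last first.
    rewrite (_ : (fun s => _) = cst 0)//; apply/funext => s.
    by rewrite nth_default// size_map.
  rewrite (_ : (fun s => _) = (fun s => - (f_clip loss C_obj (W s + (- nth 0 Phi l) *: G s) D +
    reg (W s + (- nth 0 Phi l) *: G s)))); last first.
    by apply/funext => s; rewrite /scores (nth_map 0)// scaleNr.
  have mWG : measurable_fun setT ((fun s => W s + (- nth 0 Phi l) *: G s) : S -> V).
    by apply: measurable_vecD => //; exact: measurable_vecZ.
  apply: measurable_funN; apply: measurable_funD; last first.
    by apply: measurable_continuous_comp => // w; exact: differentiable_continuous.
  rewrite /f_clip; apply: measurable_sum => r; apply: measurable_minr => //.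
  by apply: (measurable_continuous_comp (f := loss^~ r)) => // w; exact: differentiable_continuous.
by apply/funext => s; rewrite /noisy_max size_map.
Qed.

(** Induction on the fuel with [W] and [G] random and the rest of the state fixed: budget, history
    and counters depend on the noise only through the NoisyMax indices, hence are constant on each
    branch. *)
Lemma measurable_run d (S : measurableType d) (D : seq record)
    (gauss : S -> nat -> 'I_p -> R) (lap : S -> nat -> nat -> R) :
  (forall k j, measurable_fun [set: S] (fun s => gauss s k j)) ->
  (forall k j, measurable_fun [set: S] (fun s => lap s k j)) ->
  forall n (W G : S -> 'rV[R]_p) rho rng hist kG kL b,
  measurable_fun [set: S] (W : S -> V) -> measurable_fun [set: S] (G : S -> V) ->
  measurable_fun [set: S] ((fun s => run loss reg rho_nmax gamma C_obj C_grad steps D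
     (gauss s) (lap s) n (St (W s) rho rng (G s) hist kG kL b)) : S -> V).
Proof.
move=> mg ml; elim=> [//|n ih] W G rho rng hist kG kL b mW mG /=.
case: (rho <= 0) => //; case: b.
  apply: ih => //; apply: measurable_vecZ; last exact: measurable_noisy_grad.
  apply: measurable_inv_ge0; first by move=> s; exact: sqrtr_ge0.
  exact/measurable_norm2/measurable_noisy_grad.
set Phi := 0 :: steps hist; set rho1 := rho - rho_nmax.
pose N s := noisy_max (scores D Phi (W s) (G s)) C_obj (Num.sqrt (2 * rho_nmax)) (lap s kL).
pose F j s := let a := nth 0 Phi j in
  if (0 < j)%N then
    run loss reg rho_nmax gamma C_obj C_grad steps D (gauss s) (lap s) n
      (St (if 0 < rho1 then W s - a *: G s else W s) rho1 rng (G s) (rcons hist a) kG kL.+1 true)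
  else let rng' := (1 + gamma) * rng in
    let g2 := noisy_grad loss reg C_grad D (gauss s) (W s) (C_grad / Num.sqrt (2 * (rng' - rng))) kG in
    run loss reg rho_nmax gamma C_obj C_grad steps D (gauss s) (lap s) n
      (St (W s) (rho1 - (rng' - rng)) rng' (rng'^-1 *: (rng *: G s + (rng' - rng) *: g2))
        (rcons hist a) kG.+1 kL.+1 false).
apply: (@measurable_fun_nat_family _ _ S V N F).
  exact: measurable_noisy_max_scores.
case=> [|j]; rewrite /F /=.
  apply: ih => //; apply: measurable_vecZ => //; apply: measurable_vecD.
    exact: measurable_vecZ.
  by apply: measurable_vecZ => //; exact: measurable_noisy_grad.
apply: ih => //; case: (0 < rho1) => //.
rewrite (_ : (fun s => _) = (fun s => W s + (- nth 0 (steps hist) j) *: G s)); last first.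
  by apply/funext => s; rewrite scaleNr.
by apply: measurable_vecD => //; exact: measurable_vecZ.
Qed.

Lemma run_exhausted D gauss lap n w rho rng g hist kG kL b : rho <= 0 ->
  run loss reg rho_nmax gamma C_obj C_grad steps D gauss lap n (St w rho rng g hist kG kL b) = w.
Proof. by case: n => [//|n] /= ->. Qed.

(** Every draw advances its counter, so the run reads only noise of index at least [kG] or [kL].
    This separates the continuation from the noise already consumed. *)
Lemma run_ext D (gauss gauss' : nat -> 'I_p -> R) (lap lap' : nat -> nat -> R) n :
  forall w rho rng g hist kG kL b,
  (forall k j, (kG <= k)%N -> gauss k j = gauss' k j) ->
  (forall k l, (kL <= k)%N -> lap k l = lap' k l) ->
  run loss reg rho_nmax gamma C_obj C_grad steps D gauss lap n (St w rho rng g hist kG kL b) =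
  run loss reg rho_nmax gamma C_obj C_grad steps D gauss' lap' n (St w rho rng g hist kG kL b).
Proof.
elim: n => [//|n ih] w rho rng g hist kG kL b hG hL /=.
case: ifP => // _.
have ngE sigma : noisy_grad loss reg C_grad D gauss w sigma kG =
                 noisy_grad loss reg C_grad D gauss' w sigma kG.
  by congr (_ + _ *: _); apply/rowP => j; rewrite !mxE hG.
have hG1 k j : (kG.+1 <= k)%N -> gauss k j = gauss' k j by move=> /ltnW; exact: hG.
have hL1 k l : (kL.+1 <= k)%N -> lap k l = lap' k l by move=> /ltnW; exact: hL.
case: b; first by rewrite ngE; exact: ih.
have -> : lap kL = lap' kL by apply/funext => l; rewrite hL.
by case: ifP => _; rewrite ?ngE; exact: ih.
Qed.

Hypothesis C_obj_gt0 : 0 < C_obj.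
Hypothesis C_grad_gt0 : 0 < C_grad.

Lemma clipped_norm2_le (v : 'rV[R]_p) :
  \sum_(j < p) (((Num.max 1 (norm2 v / C_grad))^-1 *: v) 0 j) ^+ 2 <= C_grad ^+ 2.
Proof.
set M := Num.max _ _.
have M1 : 1 <= M by rewrite le_max lexx.
have M2 : norm2 v <= M * C_grad by rewrite -ler_pdivrMr// le_max lexx orbT.
under eq_bigr do rewrite mxE exprMn.
rewrite -mulr_sumr -(@sqr_sqrtr _ (\sum_(j < p) v 0 j ^+ 2)); last first.
  by apply: sumr_ge0 => j _; exact: sqr_ge0.
rewrite -/(norm2 v) -exprMn.
have M0 : 0 < M by exact: lt_le_trans M1.
have n0 : 0 <= norm2 v by exact: sqrtr_ge0.
have Mi0 : 0 <= M^-1 by rewrite invr_ge0 ltW.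
apply: lerXn2r; rewrite ?nnegrE ?(ltW C_grad_gt0)// ?mulr_ge0//.
by rewrite ler_pdivrMl.
Qed.

Lemma clipped_grad_sum_sensitivity (D D' : seq record) (w : 'rV[R]_p) : neighbors D D' ->
  \sum_(j < p) ((clipped_grad_sum loss C_grad w D - clipped_grad_sum loss C_grad w D') 0 j) ^+ 2
  <= C_grad ^+ 2.
Proof.
move=> [[r DD']|[r DD']]; rewrite /clipped_grad_sum (perm_big _ DD') big_cons /=.
- set S := \sum_(_ <- D) _; under eq_bigr do rewrite opprD addrCA subrr addr0 mxE sqrrN.
  exact: clipped_norm2_le.
- by rewrite addrK; exact: clipped_norm2_le.
Qed.

(** The additional record contributes a clipped loss between 0 and [C_obj], so the direction of the
    change is the same for every [w]. *)
Lemma f_clip_sensitivity (D D' : seq record) : neighbors D D' ->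
  (forall w, 0 <= f_clip loss C_obj w D' - f_clip loss C_obj w D <= C_obj) \/
  (forall w, 0 <= f_clip loss C_obj w D - f_clip loss C_obj w D' <= C_obj).
Proof.
by move=> [[r DD']|[r DD']]; [left|right] => w;
  rewrite /f_clip (perm_big _ DD') big_cons /= addrK le_min loss_ge0 ltW//= ge_min lexx orbT.
Qed.

(** The regularizer cancels, and the two differences have a common sign and lie in one interval of
    length [C_obj]; with unrelated signs the bound would be [2 * C_obj]. *)
Lemma scores_sensitivity (D D' : seq record) (Phi : seq R) (w g : 'rV[R]_p) (l l' : nat) :
  neighbors D D' -> (l < size Phi)%N -> (l' < size Phi)%N ->
  (nth 0 (scores D' Phi w g) l - nth 0 (scores D Phi w g) l) -
  (nth 0 (scores D' Phi w g) l' - nth 0 (scores D Phi w g) l') <= C_obj.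
Proof.
move=> DD' lP l'P; rewrite /scores !(nth_map 0)//.
by case: (f_clip_sensitivity DD') => h;
  have /andP[a1 a2] := h (w - nth 0 Phi l *: g);
  have /andP[b1 b2] := h (w - nth 0 Phi l' *: g); lra.
Qed.

End algorithm.

(** * Privacy of the run *)

(* Dual form of a bound [r] on the Renyi divergence of order [a] between the laws
   of [X] and [Y], normalised as in zCDP: by Hoelder's inequality it is equivalent
   to [D_a <= a * r]. *)
Definition renyi_close d0 (T : measurableType d0) (R : realType) (L : set T -> \bar R)
    (a r : R) d (Z : measurableType d) (X Y : T -> Z) : Prop :=
  forall u : Z -> \bar R, measurable_fun [set: Z] u -> (forall z, 0 <= u z)%E ->
  (\int[L]_x (u (X x) `^ ((a - 1) / a)) <=
   (expR ((a - 1) * r))%:E * (\int[L]_x u (Y x)) `^ ((a - 1) / a))%E.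

Section privacy_of_run.
Context {R : realType} {p : nat}.
Local Notation V := (@out_space R p).
Local Notation record := ('rV[R]_p * R)%type.
Local Notation index := ((nat * 'I_p) + (nat * nat))%type.
Local Notation nz := (@noise R index).
Variable L : probability nz R.
Hypothesis L_indep : independent_coords L.
Hypothesis L_gauss : forall k j, coord_density L (inl (k, j)) (normal_pdf 0 1).
Hypothesis L_lap : forall k l,
  coord_density L (inr (k, l)) (fun t => (2 * 1)^-1 * expR (- `|t| / 1)).

Variables (loss : 'rV[R]_p -> record -> R) (reg : 'rV[R]_p -> R).
Hypothesis loss_ge0 : forall w r, 0 <= loss w r.
Hypothesis loss_diff : forall r w, differentiable (loss^~ r) w.
Hypothesis reg_diff : forall w, differentiable reg w.
Variables (rho_nmax gamma C_obj C_grad : R) (steps : seq R -> seq R).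
Hypothesis rho_nmax_gt0 : 0 < rho_nmax.
Hypothesis gamma_gt0 : 0 < gamma.
Hypothesis C_obj_gt0 : 0 < C_obj.
Hypothesis C_grad_gt0 : 0 < C_grad.
Variables (D D' : seq record).
Hypothesis DD' : neighbors D D'.
Variable a : R.
Hypothesis a_gt1 : 1 < a.

Let gauss_of (x : nz) (k : nat) (j : 'I_p) : R := x (inl (k, j)).
Let lap_of (x : nz) (k l : nat) : R := x (inr (k, l)).

Let measurable_gauss_of k j : measurable_fun [set: nz] (fun x => gauss_of x k j).
Proof. exact: measurable_coord. Qed.

Let measurable_lap_of k l : measurable_fun [set: nz] (fun x => lap_of x k l).
Proof. exact: measurable_coord. Qed.

(** In units of [sigma], changing the database shifts the Gaussian vector by [c / sigma], whose
    squared norm is at most [C_grad^2 / sigma^2 = 2 * r0]; this costs [r0]. The continuation does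
    not read draw [kG], so composition adds [r]. *)
Lemma gauss_step (r0 r sigma : R) (w : 'rV[R]_p) (kG : nat) (F F' : V -> nz -> V) :
  0 < r0 -> sigma = C_grad / Num.sqrt (2 * r0) ->
  measurable_fun [set: V * nz] (fun zx => F zx.1 zx.2) ->
  measurable_fun [set: V * nz] (fun zx => F' zx.1 zx.2) ->
  (forall z x y, (forall i, (if i is inl (k, _) then k != kG else true) -> x i = y i) ->
     F z x = F z y) ->
  (forall z x y, (forall i, (if i is inl (k, _) then k != kG else true) -> x i = y i) ->
     F' z x = F' z y) ->
  (forall z, renyi_close L a r (F z) (F' z)) ->
  renyi_close L a (r0 + r)
    (fun x => F (noisy_grad loss reg C_grad D (gauss_of x) w sigma kG) x)
    (fun x => F' (noisy_grad loss reg C_grad D' (gauss_of x) w sigma kG) x).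
Proof.
move=> r00 sE mF mF' FA F'A FF' u mu_ u0.
pose A : pred index := fun i => if i is inl (k, _) then k == kG else false.
have nA i : ~~ A i = (if i is inl (k, _) then k != kG else true).
  by case: i => [[k j]|].
rewrite mulrDr expRD.
pose ng E x : V := noisy_grad loss reg C_grad E (gauss_of x) w sigma kG.
have mng E : measurable_fun [set: nz] (ng E) by exact: measurable_noisy_grad.
have ngA E x y : (forall i, A i -> x i = y i) -> ng E x = ng E y.
  move=> xy; congr (_ + _ *: _); apply/rowP => j; rewrite !mxE.
  by apply: xy; rewrite /A eqxx.
apply: (@adaptive_composition _ _ L L_indep A _ V (ng D) (ng D')
  (fun z x => u (F z x)) (fun z x => u (F' z x))) => //.
- exact: ngA.
- exact: ngA.
- exact: (measurableT_comp mu_ mF).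
- exact: (measurableT_comp mu_ mF').
- by move=> z x y xy; congr u; apply: FA => i; rewrite -nA; exact: xy.
- by move=> z x y xy; congr u; apply: F'A => i; rewrite -nA; exact: xy.
- by move=> z; exact: FF'.
move=> G mG G0.
have s0 : 0 < sigma by rewrite sE divr_gt0// sqrtr_gt0 mulr_gt0.
pose c := clipped_grad_sum loss C_grad w D - clipped_grad_sum loss C_grad w D'.
pose m (i : index) : R := if i is inl (_, j) then c 0 j / sigma else 0.
pose s : seq index := [seq inl (kG, j) | j <- enum 'I_p].
have ngE x : ng D x = ng D' (shift_coords s m x).
  apply/rowP => j; rewrite /ng /noisy_grad !mxE /gauss_of /shift_coords mem_map ?mem_enum; last first.
    by move=> i1 i2 [].
  rewrite /= /c !mxE; field.
  by rewrite gt_eqF.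
under eq_integral do rewrite ngE.
apply: (gaussian_dual (s := s) L_indep) => //.
- by rewrite map_inj_uniq ?enum_uniq// => i1 i2 [].
- by move=> i /mapP[j _ ->].
- rewrite big_map big_enum /=.
  under eq_bigr do rewrite expr_div_n.
  rewrite -mulr_suml ler_pdivrMr ?exprn_gt0//.
  have -> : 2 * r0 * sigma ^+ 2 = C_grad ^+ 2.
    rewrite sE expr_div_n sqr_sqrtr ?mulr_ge0 ?ltW// mulrC divfK//.
    by rewrite gt_eqF// mulr_gt0.
  exact: clipped_grad_sum_sensitivity.
- exact: (measurableT_comp mG (mng D')).
Qed.

(** Adding [eps] to the Laplace variable of index [j] maps the event that [j] wins for [E] into the
    event that it wins for [E'], and this translation costs a factor of at most [expR eps]. *)
Lemma noisy_max_scores_pure_dp (E E' : seq record) (Phi : seq R) (w g : 'rV[R]_p)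
    (eps : R) (kL j : nat) : neighbors E E' -> (0 < size Phi)%N -> 0 < eps ->
  (L [set x | noisy_max (scores loss reg C_obj E Phi w g) C_obj eps (lap_of x kL) = j] <=
   (expR eps)%:E *
   L [set x | noisy_max (scores loss reg C_obj E' Phi w g) C_obj eps (lap_of x kL) = j])%E.
Proof.
move=> EE' P0 e0.
pose N B (x : nz) := noisy_max (scores loss reg C_obj B Phi w g) C_obj eps (lap_of x kL).
have mN B : measurable_fun [set: nz] (N B) by exact: measurable_noisy_max_scores.
have mNj B : measurable [set x | N B x = j].
  by have := mN B measurableT [set j] I; rewrite setTI.
pose Psi x : \bar R := (\1_[set x | N E' x = j] x)%:E.
have mPsi : measurable_fun [set: nz] Psi.
  by apply/measurable_EFinP; exact: measurable_indic.
have <- : (\int[L]_x Psi x = L [set x | N E' x = j])%E by rewrite integral_indic// setIT.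
apply: le_trans (laplace_shift_le L_indep (ltW e0) (L_lap kL j) mPsi _); last first.
  by move=> x; rewrite lee_fin.
have -> : (L [set x | N E x = j] = \int[L]_x (\1_[set x | N E x = j] x)%:E)%E.
  by rewrite integral_indic// setIT.
apply: ge0_le_integral => //.
- by apply/measurable_EFinP; exact: measurable_indic.
- exact: (measurableT_comp mPsi (measurable_shift1 (inr (kL, j)) eps)).
move=> x _; rewrite lee_fin !indicE; case: (boolP (x \in _)) => // /set_mem /= Nj.
rewrite mem_set//= /N.
rewrite (_ : lap_of _ kL = (fun l => if l == j then lap_of x kL l + eps else lap_of x kL l)).
  apply: (noisy_max_shift _ _ _ _ _ Nj) => //; rewrite ?size_map//.
  by move=> l l' lP l'P; exact: scores_sensitivity.
apply/funext => l; rewrite /lap_of /shift1.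
have -> : ((inr (kL, l) : index) == inr (kL, j)) = (l == j).
  by apply/eqP/eqP => [[]//|->].
by [].
Qed.

(** For [eps = sqrt (2 * rho_nmax)] the pure DP cost [eps^2 / 2] is [rho_nmax]. The continuation
    reads no Laplace variable of call [kL], so composition applies. *)
Lemma noisy_max_step (r : R) (Phi : seq R) (w g : 'rV[R]_p) (kL : nat) (F F' : nat -> nz -> V) :
  (0 < size Phi)%N ->
  (forall j, measurable_fun [set: nz] (F j)) -> (forall j, measurable_fun [set: nz] (F' j)) ->
  (forall z x y, (forall i, (if i is inr (k, _) then k != kL else true) -> x i = y i) ->
     F z x = F z y) ->
  (forall z x y, (forall i, (if i is inr (k, _) then k != kL else true) -> x i = y i) ->
     F' z x = F' z y) ->
  (forall z, renyi_close L a r (F z) (F' z)) ->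
  let N E x := noisy_max (scores loss reg C_obj E Phi w g) C_obj
                 (Num.sqrt (2 * rho_nmax)) (lap_of x kL) in
  renyi_close L a (rho_nmax + r) (fun x => F (N D x) x) (fun x => F' (N D' x) x).
Proof.
move=> P0 mF mF' FA F'A FF' N u mu_ u0.
pose A : pred index := fun i => if i is inr (k, _) then k == kL else false.
have nA i : ~~ A i = (if i is inr (k, _) then k != kL else true).
  by case: i => [|[k l]].
rewrite mulrDr expRD.
have mN E : measurable_fun [set: nz] (N E) by exact: measurable_noisy_max_scores.
have NA E x y : (forall i, A i -> x i = y i) -> N E x = N E y.
  move=> xy; rewrite /N; congr noisy_max; apply/funext => l.
  by apply: xy; rewrite /A eqxx.
have mU H : (forall j, measurable_fun [set: nz] (H j)) ->
    measurable_fun [set: nat * nz] (fun zx => u (H zx.1 zx.2)).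
  move=> mH; apply: (measurableT_comp mu_).
  apply: (@measurable_fun_nat_family _ _ _ V fst (fun j zx => H j zx.2)) => // j.
  exact: (measurableT_comp (mH j)).
apply: (@adaptive_composition _ _ L L_indep A _ nat (N D) (N D')
  (fun z x => u (F z x)) (fun z x => u (F' z x))) => //.
- exact: NA.
- exact: NA.
- exact: mU.
- exact: mU.
- by move=> z x y xy; congr u; apply: FA => i; rewrite -nA; exact: xy.
- by move=> z x y xy; congr u; apply: F'A => i; rewrite -nA; exact: xy.
- by move=> z; exact: FF'.
move=> G mG G0.
have e0 : 0 < Num.sqrt (2 * rho_nmax) by rewrite sqrtr_gt0 mulr_gt0.
(* The likelihood ratio must be bounded above and below, so pure DP is used in both directions. *)
have D'D : neighbors D' D by case: DD' => h; [right|left].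
have Nlt E x : (N E x < size Phi)%N.
  rewrite /N /noisy_max; set s := [seq _ | _ <- _].
  have sz : size s = size Phi by rewrite size_map size_iota size_map.
  by rewrite -sz; apply: (proj1 (argmax_first_spec _)); rewrite sz.
have := pure_dp_dual a_gt1 e0 (mN D) (mN D') (Nlt D) (Nlt D') _ _ G0.
have -> : Num.sqrt (2 * rho_nmax) ^+ 2 / 2 = rho_nmax.
  by rewrite sqr_sqrtr; [field|rewrite mulr_ge0// ltW].
by apply => j; exact: noisy_max_scores_pure_dp.
Qed.

Lemma renyi_close_cst (r : R) (w : V) : 0 <= r ->
  renyi_close L a r (fun=> w) (fun=> w).
Proof.
move=> r0 u _ u0.
rewrite (_ : (fun x => _) = cst (u w `^ ((a - 1) / a))%E)//.
rewrite (_ : (fun x : nz => u w) = cst (u w))//.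
have cstE (c : \bar R) : (\int[L]_x cst c x = c)%E.
  by rewrite integral_cst// [X in (_ * X)%E](@probability_setT _ _ _ L) mule1.
rewrite !cstE -[leLHS]mul1e; apply: lee_wpmul2r; first exact: poweR_ge0.
by rewrite lee_fin -[leLHS]expR0 ler_expR mulr_ge0// subr_ge0 ltW.
Qed.

(** Induction on the fuel: a step that leaves a positive budget is paid from it, and a step that
    does not makes both runs return [w]. *)
Lemma run_close n : forall w rho rng g hist kG kL b, 0 < rho -> 0 < rng ->
  let rn E x := run loss reg rho_nmax gamma C_obj C_grad steps E (gauss_of x) (lap_of x) n
     (St w rho rng g hist kG kL b) : V in
  renyi_close L a rho (rn D) (rn D').
Proof.
elim: n => [|n ih] w rho rng g hist kG kL b rho0 rng0 /=.
  by apply: renyi_close_cst; exact: ltW.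
rewrite leNgt rho0 /=.
have mrun d (S : measurableType d) (Xs : S -> nz) E W G rho' rng' hist' kG' kL' b' :
    measurable_fun setT Xs ->
    measurable_fun setT (W : S -> V) -> measurable_fun setT (G : S -> V) ->
    measurable_fun setT ((fun s => run loss reg rho_nmax gamma C_obj C_grad steps E
      (gauss_of (Xs s)) (lap_of (Xs s)) n (St (W s) rho' rng' (G s) hist' kG' kL' b')) : S -> V).
  move=> mX mW mG; apply: measurable_run => // k j.
    exact: (measurableT_comp (measurable_gauss_of k j) mX).
  exact: (measurableT_comp (measurable_lap_of k j) mX).
case: b.
  (* If the gradient exhausts the budget, the run stops at [w] whatever the noise. *)
  have [rle|rgt] := lerP (rho - rng) 0.
    rewrite (_ : (fun x => _) = fun=> w); last by apply/funext => x; rewrite run_exhausted.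
    rewrite (_ : (fun x => _) = fun=> w); last by apply/funext => x; rewrite run_exhausted.
    by apply: renyi_close_cst; exact: ltW.
  pose F E (z : V) (x : nz) : V := run loss reg rho_nmax gamma C_obj C_grad steps E
      (gauss_of x) (lap_of x) n (St w (rho - rng) rng ((norm2 (z : 'rV[R]_p))^-1 *: (z : 'rV[R]_p)) hist kG.+1 kL false).
  have mF E : measurable_fun setT (fun zx : V * nz => F E zx.1 zx.2).
    apply: mrun => //; apply: measurable_vecZ => //.
    apply: measurable_inv_ge0; first by move=> s; exact: sqrtr_ge0.
    exact: measurable_norm2.
  have FA E z x y : (forall i, (if i is inl (k, _) then k != kG else true) -> x i = y i) ->
      F E z x = F E z y.
    move=> xy; apply: run_ext => k l kle; apply: xy => //=.
    by rewrite gtn_eqF.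
  have := @gauss_step rng (rho - rng) _ w kG (F D) (F D') rng0 erefl
    (mF D) (mF D') (FA D) (FA D').
  by rewrite subrKC; apply => z; apply: ih.
set Phi := 0 :: steps hist; set rho1 := rho - rho_nmax.
pose F E (j : nat) (x : nz) : V := let c := nth 0 Phi j in
  if (0 < j)%N then
    run loss reg rho_nmax gamma C_obj C_grad steps E (gauss_of x) (lap_of x) n
      (St (if 0 < rho1 then w - c *: g else w) rho1 rng g (rcons hist c) kG kL.+1 true)
  else let rng' := (1 + gamma) * rng in
    let g2 := noisy_grad loss reg C_grad E (gauss_of x) w (C_grad / Num.sqrt (2 * (rng' - rng))) kG in
    run loss reg rho_nmax gamma C_obj C_grad steps E (gauss_of x) (lap_of x) n
      (St w (rho1 - (rng' - rng)) rng' (rng'^-1 *: (rng *: g + (rng' - rng) *: g2))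
        (rcons hist c) kG.+1 kL.+1 false).
pose N E x := noisy_max (scores loss reg C_obj E Phi w g) C_obj (Num.sqrt (2 * rho_nmax)) (lap_of x kL).
change (renyi_close L a rho (fun x => F D (N D x) x) (fun x => F D' (N D' x) x)).
have grng : (1 + gamma) * rng - rng = gamma * rng by ring.
have grng0 : 0 < gamma * rng by exact: mulr_gt0.
(* If NoisyMax exhausts the budget, neither branch assigns a new iterate: for a positive index the
   test [0 < rho1] fails, and for index 0 the second gradient only lowers the budget further. *)
have [rle|rgt] := lerP rho1 0.
  have Fw E j x : F E j x = w.
    rewrite /F /=; case: ifP => _; rewrite run_exhausted//; first by rewrite ltNge rle.
    by rewrite grng; lra.
  rewrite (_ : (fun x => _) = fun=> w); last by apply/funext => x; rewrite Fw.
  rewrite (_ : (fun x => _) = fun=> w); last by apply/funext => x; rewrite Fw.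
  by apply: renyi_close_cst; exact: ltW.
have -> : rho = rho_nmax + rho1 by rewrite /rho1 addrC subrK.
have mF E j : measurable_fun setT (F E j).
  rewrite /F; case: (0 < j)%N; first exact: (mrun _ _ id E (fun=> _) (fun=> g)).
  apply: (mrun _ _ id E (fun=> w)) => //; apply: measurable_vecZ => //.
  apply: measurable_vecD; first exact: measurable_cst.
  by apply: measurable_vecZ => //; exact: measurable_noisy_grad.
have FA E j x y : (forall i, (if i is inr (k, _) then k != kL else true) -> x i = y i) ->
    F E j x = F E j y.
  move=> xy.
  have gE k l : gauss_of x k l = gauss_of y k l by exact: xy.
  have lE k l : (kL < k)%N -> lap_of x k l = lap_of y k l.
    by move=> kk; apply: xy; rewrite /= gtn_eqF.
  rewrite /F /=; case: ifP => _; first by apply: run_ext.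
  rewrite (_ : gauss_of x = gauss_of y); last by apply/funext => k; apply/funext => l.
  exact: run_ext.
apply: noisy_max_step => //.
- exact: FA.
- exact: FA.
case=> [|j]; rewrite /F /=; last exact: ih.
rewrite grng.
have [rle2|rgt2] := lerP (rho1 - gamma * rng) 0.
  rewrite (_ : (fun x => _) = fun=> w); last by apply/funext => x; rewrite run_exhausted.
  rewrite (_ : (fun x => _) = fun=> w); last by apply/funext => x; rewrite run_exhausted.
  by apply: renyi_close_cst; exact: ltW.
(* Averaging with the old direction [g] is post-processing of the fresh gradient [z], so only the
   increment [gamma * rng] is charged. *)
pose H E (z : V) (x : nz) : V := run loss reg rho_nmax gamma C_obj C_grad steps E
   (gauss_of x) (lap_of x) n
   (St w (rho1 - gamma * rng) ((1 + gamma) * rng)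
     (((1 + gamma) * rng)^-1 *: (rng *: g + (gamma * rng) *: (z : 'rV[R]_p)))
     (rcons hist 0) kG.+1 kL.+1 false).
have mH E : measurable_fun setT (fun zx : V * nz => H E zx.1 zx.2).
  apply: mrun => //; apply: measurable_vecZ => //.
  apply: measurable_vecD; first exact: measurable_cst.
  exact: measurable_vecZ.
have HA E z x y : (forall i, (if i is inl (k, _) then k != kG else true) -> x i = y i) ->
    H E z x = H E z y.
  move=> xy; apply: run_ext => k l kle; apply: xy => //=.
  by rewrite gtn_eqF.
have := @gauss_step (gamma * rng) (rho1 - gamma * rng) _ w kG (H D) (H D') grng0 erefl
  (mH D) (mH D') (HA D) (HA D').
rewrite subrKC; apply => z; apply: ih => //.
by rewrite mulr_gt0// addr_gt0.
Qed.

End privacy_of_run.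

(** * Transfer to the given probability space *)

Lemma measurable_noise_family (R : realType) (p : nat) d (Omega : measurableType d)
    (gauss : nat -> 'I_p -> Omega -> R)
    (lap : nat -> nat -> Omega -> R) :
  (forall k j, measurable_fun [set: Omega] (gauss k j)) ->
  (forall k j, measurable_fun [set: Omega] (lap k j)) ->
  measurable_fun [set: Omega]
    ((fun omega i => noise_family gauss lap i omega) : Omega -> @noise R _).
Proof.
move=> mg ml; apply: measurable_to_noise => -[[k j]|[k l]]; [exact: mg|exact: ml].
Qed.

Lemma independent_coords_distribution (R : realType) (I : choiceType) d
    (Omega : measurableType d) (P : probability Omega R)
    (Y : I -> Omega -> R) (X : {mfun Omega >-> @noise R I}) :
  (forall omega i, X omega i = Y i omega) -> mutually_independent P Y ->
  independent_coords (distribution P X).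
Proof.
move=> XY indep s B us mB.
have := indep s us B mB; rewrite (_ : \big[setI/setT]_(i <- s) _ =
  X @^-1` [set x | forall i, i \in s -> B i (x i)]); last first.
  rewrite -bigcap_seq; apply/seteqP; split => w h i si /=.
    by rewrite XY; exact: h.
  by have /= := h i si; rewrite XY.
rewrite /distribution /pushforward => ->; apply: eq_bigr => i _; congr (P _).
by apply/seteqP; split => w /=; rewrite XY.
Qed.

(** Integrals over the laws of [M] and [M'] pull back to the noise space, so [close] is the dual
    bound between these two laws. The density it yields gives both conclusions. *)
Lemma privacy_of_renyi_close d (Omega : measurableType d) d1 (T : measurableType d1)
    d2 (Z : measurableType d2) (R : realType) (P : probability Omega R)
    (X : {mfun Omega >-> T}) (Y Y' : T -> Z) (a r : R) : 1 < a -> 0 <= r ->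
  measurable_fun [set: T] Y -> measurable_fun [set: T] Y' ->
  renyi_close (distribution P X) a r Y Y' ->
  let M omega := Y (X omega) in let M' omega := Y' (X omega) in
  (renyi_div a (pushforward P M) (pushforward P M') <= (a * r)%:E)%E /\
  forall eps S, measurable S ->
    (P (M @^-1` S) <=
     (expR eps)%:E * P (M' @^-1` S) + (expR ((a - 1) * (a * r - eps)))%:E)%E.
Proof.
move=> a1 r0 mY mY' close.
have mX : measurable_fun [set: Omega] X by exact: measurable_funPT.
pose M : {mfun Omega >-> Z} := mfun_Sub (mem_set (measurableT_comp mY mX)).
pose M' : {mfun Omega >-> Z} := mfun_Sub (mem_set (measurableT_comp mY' mX)).
have intE (h : T -> Z) (N : {mfun Omega >-> Z}) (v : Z -> \bar R) :
    (fun omega => h (X omega)) = N -> measurable_fun [set: T] h ->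
    measurable_fun [set: Z] v -> (forall z, 0 <= v z)%E ->
    (\int[distribution P N]_z v z = \int[distribution P X]_x v (h x))%E.
  move=> NE mh mv v0; rewrite ge0_integral_distribution//.
  rewrite (ge0_integral_distribution X (f := fun x => v (h x)))//.
    by rewrite -NE.
  exact: (measurableT_comp mv mh).
have [|f [df fle]] := @density_of_dual _ _ R (distribution P M) (distribution P M') a r a1.
  move=> u mu_ u0.
  have muth : measurable_fun setT (fun z => u z `^ ((a - 1) / a))%E.
    apply: (@measurableT_comp _ _ _ _ _ _ (fun x : \bar R => x `^ ((a - 1) / a))%E _ _ _ mu_).
    exact: measurable_poweR.
  rewrite (intE Y M _ erefl mY muth (fun=> poweR_ge0 _ _)) (intE Y' M' u erefl mY' mu_ u0).
  exact: close.
split; first exact: (@renyi_div_le _ _ _ _ (distribution P M') f a r a1 r0 df fle).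
by move=> eps S mS; exact: (@le_of_density _ _ _ _ (distribution P M') f a r eps a1 df fle S mS).
Qed.

Lemma zCDP_DP_of_renyi_close d (Omega : measurableType d) d1 (T : measurableType d1)
    d2 (Z : measurableType d2) (R : realType) (P : probability Omega R) (U : eqType)
    (X : {mfun Omega >-> T}) (Y : seq U -> T -> Z) (eps delta rho : R) :
  0 < delta < 1 -> 0 < rho -> eps = rho + 2 * Num.sqrt (rho * ln delta^-1) ->
  (forall D, measurable_fun [set: T] (Y D)) ->
  (forall D D', neighbors D D' -> forall a, 1 < a ->
     renyi_close (distribution P X) a rho (Y D) (Y D')) ->
  zCDP P (fun D omega => Y D (X omega)) rho /\
  DP P (fun D omega => Y D (X omega)) eps delta.
Proof.
move=> /andP[del0 del1] rho0 epsE mY close.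
split=> D D' DD'.
  move=> a a1.
  exact: (privacy_of_renyi_close a1 (ltW rho0) (mY D) (mY D') (close D D' DD' a a1)).1.
move=> S mS.
have L0 : 0 < ln delta^-1 by rewrite ln_gt0// invf_gt1.
pose s := Num.sqrt (rho * ln delta^-1).
have s0 : 0 < s by rewrite sqrtr_gt0 mulr_gt0.
(* This order [a] minimises [(a - 1) * (a * rho - eps)]. *)
have a1 : 1 < 1 + s / rho by rewrite ltrDl divr_gt0.
have [_ /(_ eps S mS)] :=
  privacy_of_renyi_close a1 (ltW rho0) (mY D) (mY D') (close D D' DD' _ a1).
have -> // : expR ((1 + s / rho - 1) * ((1 + s / rho) * rho - eps)) = delta.
have s2 : s ^+ 2 = rho * ln delta^-1 by rewrite sqr_sqrtr// ltW// mulr_gt0.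
(* At this order the exponent is [- s^2 / rho = - ln delta^-1], so the additive term is exactly
   [delta]. *)
rewrite epsE -/s (_ : _ * _ = - (s ^+ 2 / rho)); last by field; rewrite gt_eqF.
by rewrite s2 mulrAC divff ?gt_eqF// mul1r lnV ?posrE// opprK lnK.
Qed.

Theorem theorem5p1 (R : realType) (p : nat)
  (* the source of randomness: a probability space carrying independent
     standard normal (gauss) and standard Laplace (lap) variables *)
  (d : measure_display) (Omega : measurableType d) (P : probability Omega R)
  (gauss : nat -> 'I_p -> Omega -> R) (lap : nat -> nat -> Omega -> R)
  (gauss_meas : forall k j, measurable_fun [set: Omega] (gauss k j))
  (lap_meas : forall k j, measurable_fun [set: Omega] (lap k j))
  (gauss_law : forall k j (B : set R), measurable B ->
     P (gauss k j @^-1` B) = normal_prob 0 1 B)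
  (lap_law : forall k j (B : set R), measurable B ->
     P (lap k j @^-1` B) = laplace_prob 1 B)
  (indep : mutually_independent P (noise_family gauss lap))
  (* the problem *)
  (loss : 'rV[R]_p -> ('rV[R]_p * R) -> R)
  (loss_ge0 : forall w r, 0 <= loss w r)
  (loss_diff : forall r w, differentiable (loss^~ r) w)
  (reg : 'rV[R]_p -> R) (reg_diff : forall w, differentiable reg w)
  (* privacy parameters and other inputs *)
  (eps_tot delta_tot rho rho_nmax rho_ng gamma C_obj C_grad : R)
  (w0 : 'rV[R]_p) (steps : seq R -> seq R) :
  0 < eps_tot -> 0 < delta_tot < 1 ->
  0 < rho -> eps_tot = rho + 2 * Num.sqrt (rho * ln (delta_tot^-1)) ->
  0 < rho_nmax -> 0 < rho_ng -> 0 < gamma -> 0 < C_obj -> 0 < C_grad ->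
  zCDP P (dpagd gauss lap loss reg rho rho_nmax rho_ng gamma C_obj C_grad w0 steps) rho
  /\ DP P (dpagd gauss lap loss reg rho rho_nmax rho_ng gamma C_obj C_grad w0 steps)
        eps_tot delta_tot.
Proof.
move=> eps0 del01 rho0 epsE rn0 rg0 gam0 Co0 Cg0.
have mX := measurable_noise_family gauss_meas lap_meas.
pose X : {mfun Omega >-> @noise R _} := mfun_Sub (mem_set mX).
(* All randomness enters through the joint law of the noise family; the mechanism is the measurable
   function [rn] below evaluated at it. *)
pose L : probability _ R := distribution P X.
have L_indep : independent_coords L.
  exact: (@independent_coords_distribution _ _ _ _ P (noise_family gauss lap)).
have L_gauss k j : coord_density L (inl (k, j)) (normal_pdf 0 1).
  split; [exact: measurable_normal_pdf|exact: normal_pdf_ge0|].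
  by move=> B mB; rewrite -[RHS]/(normal_prob 0 1 B) -(gauss_law k j).
have L_lap k l : coord_density L (inr (k, l)) (fun t => (2 * 1)^-1 * expR (- `|t| / 1)).
  split.
  - apply: measurable_funM => //; apply: measurableT_comp; first exact: measurable_expR.
    apply: measurable_funM => //; apply: measurable_funN; exact: normr_measurable.
  - by move=> t; rewrite mulr_ge0 ?expR_ge0.
  - by move=> B mB; rewrite -[RHS]/(laplace_prob 1 B) -(lap_law k l).
pose rn E (x : @noise R _) : @out_space R p :=
  run loss reg rho_nmax gamma C_obj C_grad steps E (fun k j => x (inl (k, j)))
    (fun k l => x (inr (k, l))) ((Num.truncn (rho / rho_nmax)).+2).*2
    (St w0 rho rho_ng 0 [::] 0 0 true).
have mrn E : measurable_fun setT (rn E).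
  by apply: measurable_run => // k j; exact: measurable_coord.
apply: (@zCDP_DP_of_renyi_close _ Omega _ _ _ (@out_space R p) R P _ X rn) => //.
move=> D D' DD' a a1.
exact: (@run_close R p L L_indep L_gauss L_lap loss reg loss_ge0 loss_diff reg_diff
  rho_nmax gamma C_obj C_grad steps rn0 gam0 Co0 Cg0 D D' DD' a a1
  ((Num.truncn (rho / rho_nmax)).+2).*2 w0 rho rho_ng 0 [::] 0 0 true rho0 rg0).
Qed.
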